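(* Assume $\beta_x=0$ for all $x\in\Gamma$ and that $J$ with domain $\mathcal F(\Gamma)$ is not essentially selfadjoint in $\ell^2(\Gamma)$. Let $(x_n)_{n\ge0}$ be an infinite path in $\Gamma$ with $\ell(x_n)=n$ (so $x_n'=x_{n+1}$). Then the classical Jacobi matrix $J_0$ on $\ell^2(\mathbb N_0)$ given by $(J_0u)(n)=\lambda_{x_n}u(n+1)+\lambda_{x_{n-1}}u(n-1)$ (with $\lambda_{x_{-1}}u(-1):=0$), with domain the finitely supported sequences, is not essentially selfadjoint.
   Context: Let $\Gamma$ be an infinite connected tree whose vertices are arranged in levels $\ell(x)\in\{0,1,2,\dots\}$: every vertex $x$ is adjacent to exactly one vertex $x'$ with $\ell(x')=\ell(x)+1$; for $\ell(x)\ge 1$ the set $N_x=\{y:\ y'=x\}$ of neighbours of $x$ on level $\ell(x)-1$ is finite and nonempty; $N_x=\emptyset$ if $\ell(x)=0$; there are no other edges. Fix $\lambda_x>0$, $\beta_x\in\mathbb R$. The Jacobi matrix $J$ acts on functions $v:\Gamma\to\mathbb C$ by $(Jv)(x)=\lambda_x v(x')+\beta_x v(x)+\sum_{y\in N_x}\lambda_y v(y)$. $\mathcal F(\Gamma)$ denotes the finitely supported functions; $J$ with domain $\mathcal F(\Gamma)$ is symmetric in $\ell^2(\Gamma)$. *)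

(* Defs.v *)
From Stdlib Require Import Reals List Relations.
Import ListNotations.
Open Scope R_scope.

Definition C := (R * R)%type.
Definition C0 : C := (0, 0).
Definition Cadd (a b : C) : C := (fst a + fst b, snd a + snd b).
Definition Csub (a b : C) : C := (fst a - fst b, snd a - snd b).
Definition Cmul (a b : C) : C :=
  (fst a * fst b - snd a * snd b, fst a * snd b + snd a * fst b).
Definition Cconj (a : C) : C := (fst a, - snd a).
Definition Rscal (r : R) (a : C) : C := (r * fst a, r * snd a).
Definition Cnorm2 (a : C) : R := fst a * fst a + snd a * snd a.

Section L2.
Variable V : Type.

Definition lsum (f : V -> R) (l : list V) : R :=
  fold_right (fun x acc => f x + acc) 0 l.

(** unconditional sum of a real family indexed by V (limit of the net of finite sums) *)
Definition has_sum (f : V -> R) (S : R) : Prop :=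
  forall eps, 0 < eps -> exists L0 : list V,
    forall L, NoDup L -> incl L0 L -> Rabs (lsum f L - S) < eps.

Definition has_sumC (f : V -> C) (s : C) : Prop :=
  has_sum (fun x => fst (f x)) (fst s) /\ has_sum (fun x => snd (f x)) (snd s).

Definition l2 (v : V -> C) : Prop := exists S, has_sum (fun x => Cnorm2 (v x)) S.

Definition inner (u v : V -> C) (s : C) : Prop :=
  has_sumC (fun x => Cmul (Cconj (u x)) (v x)) s.

Definition l2_conv (u : nat -> V -> C) (v : V -> C) : Prop :=
  forall eps, 0 < eps -> exists N, forall n, (N <= n)%nat ->
    exists S, has_sum (fun x => Cnorm2 (Csub (u n x) (v x))) S /\ S < eps.

Definition fin_supp (u : V -> C) : Prop :=
  exists L : list V, forall x, ~ In x L -> u x = C0.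

Definition closure_graph (A : (V -> C) -> (V -> C)) (v w : V -> C) : Prop :=
  l2 v /\ l2 w /\
  exists u : nat -> V -> C,
    (forall n, fin_supp (u n)) /\ l2_conv u v /\ l2_conv (fun n => A (u n)) w.

Definition adjoint_closure_graph (A : (V -> C) -> (V -> C)) (v w : V -> C) : Prop :=
  l2 v /\ l2 w /\
  forall u z, closure_graph A u z -> exists s, inner z v s /\ inner u w s.

Definition ess_selfadjoint (A : (V -> C) -> (V -> C)) : Prop :=
  forall v w, closure_graph A v w <-> adjoint_closure_graph A v w.

(** Leveled tree structure: par x = x', ch x = N_x (listed without repetition). *)
Definition adj (par : V -> V) (x y : V) : Prop := y = par x \/ x = par y.

Definition leveled_tree (lev : V -> nat) (par : V -> V) (ch : V -> list V) : Prop :=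
  (forall x, lev (par x) = S (lev x)) /\
  (forall x y, In y (ch x) <-> par y = x) /\
  (forall x, NoDup (ch x)) /\
  (forall x, (1 <= lev x)%nat -> ch x <> nil) /\
  (forall x y, clos_refl_trans V (adj par) x y).

Definition jacobi (par : V -> V) (ch : V -> list V) (lam beta : V -> R)
  (v : V -> C) : V -> C :=
  fun x => Cadd (Cadd (Rscal (lam x) (v (par x))) (Rscal (beta x) (v x)))
                (fold_right (fun y acc => Cadd (Rscal (lam y) (v y)) acc) C0 (ch x)).

End L2.

Arguments lsum {V}. Arguments has_sum {V}. Arguments has_sumC {V}. Arguments l2 {V}.
Arguments inner {V}. Arguments l2_conv {V}. Arguments fin_supp {V}.
Arguments closure_graph {V}. Arguments adjoint_closure_graph {V}.
Arguments ess_selfadjoint {V}. Arguments adj {V}. Arguments leveled_tree {V}.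
Arguments jacobi {V}.

(** The half-line N_0 as a leveled tree: n' = n+1, N_n = {n-1}. *)
Definition nat_children (n : nat) : list nat :=
  match n with O => [] | S m => [m] end.

Definition J0 (a : nat -> R) : (nat -> C) -> (nat -> C) :=
  jacobi S nat_children a (fun _ => 0).

(* Main.v *)
(* After conjugation with [i ^ level], the Jacobi matrix with zero diagonal is
   [i] times the real skew-symmetric matrix
   [(B f) x = lam x * f x' - sum_{y in N_x} lam y * f y], and the equation
   [B p = p] has a positive solution [p] on the tree.
   If [p] is not in l2, then [J] is essentially selfadjoint: with
   [Gamma_n] the subtree below [x_n], a domain vector [f] is approximated by
   [1_{Gamma_n} (f + (a / 2) r - c p)], where [r = (-1)^level p] solves
   [B r = - r], [c] makes the function vanish at [x_{n+1}], and [a] is the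
   coefficient of the projection of [(B - 1) f] on [r] over
   [Gamma_n] and [x_{n+1}]; it tends to zero because the norm of [r] there is
   unbounded, and skew symmetry gives [|u| <= |(B - 1) u|].
   Hence [p] is in l2.  Along the path, [p] dominates up to a constant the
   analogous solution [q] on the half-line, since dropping the contributions of
   the other children only decreases it.  So [q] is in l2, and [i ^ n q_n] is an
   eigenvector of the adjoint of [J0] for the eigenvalue [i]. *)

Require Import Defs.
From Stdlib Require Import Reals List Relations.
From Stdlib Require Import Permutation Lra Lia Classical ClassicalEpsilon.
Open Scope R_scope.

(** * Sums and square-summable families *)

Section Sums.
Context {V : Type}.
Implicit Types (f g : V -> R) (L K : list V).

Definition eq_dec (x y : V) : {x = y} + {x <> y} :=
  excluded_middle_informative (x = y).

Lemma lsum_ext f g L :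
  (forall x, In x L -> f x = g x) -> lsum f L = lsum g L.
Proof.
  induction L as [|a L IH]; simpl; intros H; [reflexivity|].
  rewrite H, IH by auto. reflexivity.
Qed.

Lemma lsum_app f L K : lsum f (L ++ K) = lsum f L + lsum f K.
Proof. induction L as [|a L IH]; simpl; [|rewrite IH]; lra. Qed.

Lemma lsum_perm f L K : Permutation L K -> lsum f L = lsum f K.
Proof. induction 1; simpl in *; lra. Qed.

Lemma lsum_plus f g L : lsum (fun x => f x + g x) L = lsum f L + lsum g L.
Proof. induction L as [|a L IH]; simpl; [|rewrite IH]; lra. Qed.

Lemma lsum_scal c f L : lsum (fun x => c * f x) L = c * lsum f L.
Proof. induction L as [|a L IH]; simpl; [|rewrite IH]; lra. Qed.

Lemma lsum_le f g L :
  (forall x, In x L -> f x <= g x) -> lsum f L <= lsum g L.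
Proof.
  induction L as [|a L IH]; simpl; intros H; [lra|].
  pose proof (H a (or_introl eq_refl)).
  assert (lsum f L <= lsum g L) by (apply IH; auto). lra.
Qed.

Lemma lsum_zero f L : (forall x, In x L -> f x = 0) -> lsum f L = 0.
Proof.
  induction L as [|a L IH]; simpl; intros H; [reflexivity|].
  rewrite H, IH by auto. lra.
Qed.

Lemma lsum_pos f L : (forall x, In x L -> 0 <= f x) -> 0 <= lsum f L.
Proof.
  intros H. rewrite <- (lsum_zero (fun _ => 0) L) by auto. now apply lsum_le.
Qed.

Lemma lsum_sqr_pos f L : 0 <= lsum (fun x => f x * f x) L.
Proof. apply lsum_pos. intros x _. nra. Qed.

Lemma lsum_flat_map (k : V -> list V) f L :
  lsum f (flat_map k L) = lsum (fun x => lsum f (k x)) L.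
Proof.
  induction L as [|a L IH]; simpl; [|rewrite lsum_app, IH]; reflexivity.
Qed.

Lemma lsum_filter (b : V -> bool) f L :
  lsum f (filter b L) = lsum (fun x => if b x then f x else 0) L.
Proof.
  induction L as [|a L IH]; simpl; [reflexivity|].
  destruct (b a); simpl; rewrite IH; lra.
Qed.

(** Induction on the list: the cross terms of a new entry are controlled by the induction hypothesis
    and the inequality of arithmetic and geometric means. *)
Lemma lsum_cauchy_schwarz f g L :
  lsum (fun x => f x * g x) L * lsum (fun x => f x * g x) L
  <= lsum (fun x => f x * f x) L * lsum (fun x => g x * g x) L.
Proof.
  induction L as [|a L IH]; simpl; [lra|].
  pose proof (lsum_sqr_pos f L) as Hf. pose proof (lsum_sqr_pos g L) as Hg.
  set (s := lsum (fun x => f x * g x) L) in *.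
  set (F := lsum (fun x => f x * f x) L) in *.
  set (G := lsum (fun x => g x * g x) L) in *.
  clearbody s F G. generalize (f a) (g a). intros p q.
  (* After squaring, this follows from [s * s <= F * G] and [4 * x * y <= (x + y)^2] with
     [x = p * p * G], [y = q * q * F]. *)
  assert (2 * (p * q) * s <= p * p * G + q * q * F); [|nra].
  apply Rsqr_incr_0_var; [|nra]. unfold Rsqr.
  pose proof (Rle_0_sqr (p * p * G - q * q * F)) as H1.
  assert (H2 : 0 <= (p * q) * (p * q) * (F * G - s * s)).
  { apply Rmult_le_pos; [apply Rle_0_sqr|lra]. }
  unfold Rsqr in H1. nra.
Qed.

Lemma nodup_exists L : exists K, NoDup K /\ forall x, In x K <-> In x L.
Proof.
  exists (nodup eq_dec L). split; [apply NoDup_nodup|]. intros x. apply nodup_In.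
Qed.

Lemma incl_split K L :
  NoDup K -> incl K L -> exists R, Permutation L (K ++ R).
Proof.
  revert L. induction K as [|a K IH]; intros L HK HL; [now exists L|].
  inversion HK as [|? ? Ha HK']; subst.
  destruct (in_split a L) as (l1 & l2 & ->); [apply HL; now left|].
  destruct (IH (l1 ++ l2)) as [R HR]; [assumption| |].
  - intros x Hx. assert (x <> a) by congruence.
    destruct (in_app_or _ _ _ (HL x (or_intror Hx))) as [|[|]];
      try congruence; apply in_or_app; auto.
  - exists R. simpl. rewrite <- HR. symmetry. apply Permutation_middle.
Qed.

Lemma lsum_incl_le f K L :
  (forall x, 0 <= f x) -> NoDup K -> incl K L -> lsum f K <= lsum f L.
Proof.
  intros Hf HK HL. destruct (incl_split K L HK HL) as [R HR].
  rewrite (lsum_perm f _ _ HR), lsum_app.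
  assert (0 <= lsum f R) by (apply lsum_pos; auto). lra.
Qed.

Lemma NoDup_app_disjoint K L x : NoDup (K ++ L) -> In x L -> ~ In x K.
Proof.
  intros HN Hx Hx'. destruct (in_split x L Hx) as (l1 & l2 & ->).
  rewrite app_assoc in HN. apply NoDup_remove_2 in HN. apply HN.
  rewrite !in_app_iff. auto.
Qed.

Lemma lsum_supp f K L :
  NoDup K -> NoDup L -> incl K L -> (forall x, ~ In x K -> f x = 0) ->
  lsum f L = lsum f K.
Proof.
  intros HK HL Hi Hf. destruct (incl_split K L HK Hi) as [R HR].
  rewrite (lsum_perm f _ _ HR), lsum_app, (lsum_zero f R); [lra|].
  intros x Hx. apply Hf.
  exact (NoDup_app_disjoint K R x (Permutation_NoDup HR HL) Hx).
Qed.

(** * Unconditional sums *)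

Lemma has_sum_ext f g s : (forall x, f x = g x) -> has_sum f s -> has_sum g s.
Proof.
  intros H Hs eps He. destruct (Hs eps He) as [L0 HL0]. exists L0. intros L HL Hi.
  rewrite <- (lsum_ext f g L) by auto. auto.
Qed.

Lemma has_sum_unique f s t : has_sum f s -> has_sum f t -> s = t.
Proof.
  intros Hs Ht. apply NNPP. intros Hn.
  assert (He : 0 < Rabs (s - t) / 2).
  { assert (0 < Rabs (s - t)) by (apply Rabs_pos_lt; lra). lra. }
  destruct (Hs _ He) as [L1 H1]. destruct (Ht _ He) as [L2 H2].
  destruct (nodup_exists (L1 ++ L2)) as (L & HL & Hin).
  specialize (H1 L HL). specialize (H2 L HL).
  assert (I1 : incl L1 L) by (intros x Hx; apply Hin, in_or_app; auto).
  assert (I2 : incl L2 L) by (intros x Hx; apply Hin, in_or_app; auto).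
  specialize (H1 I1). specialize (H2 I2).
  clear -H1 H2. unfold Rabs in *.
  repeat destruct Rcase_abs; lra.
Qed.

Lemma has_sum_plus f g s t :
  has_sum f s -> has_sum g t -> has_sum (fun x => f x + g x) (s + t).
Proof.
  intros Hs Ht eps He.
  destruct (Hs (eps / 2)) as [L1 H1]; [lra|].
  destruct (Ht (eps / 2)) as [L2 H2]; [lra|].
  exists (L1 ++ L2). intros L HL Hi. rewrite lsum_plus.
  apply incl_app_inv in Hi. destruct Hi as [I1 I2].
  specialize (H1 L HL I1). specialize (H2 L HL I2).
  replace (lsum f L + lsum g L - (s + t))
    with ((lsum f L - s) + (lsum g L - t)) by ring.
  eapply Rle_lt_trans; [apply Rabs_triang|]. lra.
Qed.

Lemma has_sum_scal c f s : has_sum f s -> has_sum (fun x => c * f x) (c * s).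
Proof.
  intros Hs eps He.
  assert (Hc : 0 < Rabs c + 1) by (pose proof (Rabs_pos c); lra).
  destruct (Hs (eps / (Rabs c + 1))) as [L0 H0]; [now apply Rdiv_lt_0_compat|].
  exists L0. intros L HL Hi. specialize (H0 L HL Hi). rewrite lsum_scal.
  replace (c * lsum f L - c * s) with (c * (lsum f L - s)) by ring.
  rewrite Rabs_mult. set (d := Rabs (lsum f L - s)) in *.
  assert (0 <= d) by apply Rabs_pos.
  assert (d * (Rabs c + 1) < eps).
  { apply Rmult_lt_reg_r with (/ (Rabs c + 1)); [now apply Rinv_0_lt_compat|].
    rewrite Rmult_assoc, Rinv_r by lra. unfold Rdiv in H0. lra. }
  nra.
Qed.

Lemma has_sum_minus f g s t :
  has_sum f s -> has_sum g t -> has_sum (fun x => f x - g x) (s - t).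
Proof.
  intros Hs Ht. replace (s - t) with (s + (-1) * t) by ring.
  apply has_sum_ext with (fun x => f x + (-1) * g x); [intros; ring|].
  apply has_sum_plus; [assumption|]. now apply has_sum_scal.
Qed.

Lemma has_sum_finite f K :
  NoDup K -> (forall x, ~ In x K -> f x = 0) -> has_sum f (lsum f K).
Proof.
  intros HK Hf eps He. exists K. intros L HL Hi.
  rewrite (lsum_supp f K L) by assumption. rewrite Rminus_diag, Rabs_R0. assumption.
Qed.

Lemma has_sum_partial_le f s L :
  (forall x, 0 <= f x) -> has_sum f s -> NoDup L -> lsum f L <= s.
Proof.
  intros Hf Hs HL. apply Rle_plus_epsilon. intros eps He.
  destruct (Hs eps He) as [L0 H0].
  destruct (nodup_exists (L ++ L0)) as (K & HK & Hin).
  assert (lsum f L <= lsum f K).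
  { apply lsum_incl_le; auto. intros x Hx. apply Hin, in_or_app; auto. }
  assert (I : incl L0 K) by (intros x Hx; apply Hin, in_or_app; auto).
  specialize (H0 K HK I). apply Rabs_def2 in H0. lra.
Qed.

Lemma has_sum_bounded f M :
  (forall x, 0 <= f x) -> (forall L, NoDup L -> lsum f L <= M) ->
  exists s, has_sum f s /\ s <= M.
Proof.
  intros Hf HM.
  destruct (completeness (fun y => exists L, NoDup L /\ y = lsum f L)) as [s [Hub Hl]].
  - exists M. intros y (L & HL & ->). auto.
  - exists 0, nil. split; [constructor|reflexivity].
  - exists s. split.
    + intros eps He.
      destruct (classic (exists L, NoDup L /\ s - eps < lsum f L)) as [(L0 & HL0 & H0)|Hn].
      * exists L0. intros L HL Hi.
        assert (lsum f L0 <= lsum f L) by now apply lsum_incl_le.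
        assert (lsum f L <= s) by (apply Hub; eauto).
        apply Rabs_def1; lra.
      * exfalso. assert (s <= s - eps); [|lra].
        apply Hl. intros y (L & HL & ->). apply Rnot_lt_le. intros Hlt. eauto.
    + apply Hl. intros y (L & HL & ->). auto.
Qed.

(** * Bounds on squared norms and convergence in l2 *)

(** Bounding all finite partial sums expresses a squared l2 norm at most [M] without first producing
    the value of the sum. *)
Definition sq_le f M : Prop :=
  forall L, NoDup L -> lsum (fun x => f x * f x) L <= M.

Definition sq_conv (u : nat -> V -> R) f : Prop :=
  forall eps, 0 < eps -> exists N, forall n, (N <= n)%nat ->
    sq_le (fun x => u n x - f x) eps.

Lemma sq_le_nonneg f M : sq_le f M -> 0 <= M.
Proof. intros H. apply (H nil). constructor. Qed.

Lemma sq_le_weaken f M M' : M <= M' -> sq_le f M -> sq_le f M'.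
Proof. intros H Hf L HL. specialize (Hf L HL). lra. Qed.

Lemma sq_le_dom f g M :
  (forall x, f x * f x <= g x * g x) -> sq_le g M -> sq_le f M.
Proof.
  intros H Hg L HL. eapply Rle_trans; [|apply (Hg L HL)]. apply lsum_le. auto.
Qed.

Lemma sq_le_plus f g A B :
  sq_le f A -> sq_le g B -> sq_le (fun x => f x + g x) (2 * A + 2 * B).
Proof.
  intros Hf Hg L HL. specialize (Hf L HL). specialize (Hg L HL).
  apply Rle_trans with (lsum (fun x => 2 * (f x * f x) + 2 * (g x * g x)) L).
  - apply lsum_le. intros x _. pose proof (Rle_0_sqr (f x - g x)) as H. unfold Rsqr in H. lra.
  - rewrite lsum_plus, !lsum_scal. lra.
Qed.

Lemma sq_le_scal c f A : sq_le f A -> sq_le (fun x => c * f x) (c * c * A).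
Proof.
  intros Hf L HL. specialize (Hf L HL).
  rewrite (lsum_ext _ (fun x => (c * c) * (f x * f x))) by (intros; ring).
  rewrite lsum_scal. apply Rmult_le_compat_l; [apply Rle_0_sqr|assumption].
Qed.

Lemma sq_le_minus f g A B :
  sq_le f A -> sq_le g B -> sq_le (fun x => f x - g x) (2 * A + 2 * B).
Proof.
  intros Hf Hg. apply sq_le_dom with (fun x => f x + (-1) * g x).
  - intros x. nra.
  - apply sq_le_plus; [assumption|].
    apply sq_le_weaken with ((-1) * (-1) * B); [lra|]. now apply sq_le_scal.
Qed.

Lemma sq_le_finite f K :
  NoDup K -> (forall x, ~ In x K -> f x = 0) ->
  sq_le f (lsum (fun x => f x * f x) K).
Proof.
  intros HK Hf L HL. apply has_sum_partial_le; [intros; nra| |assumption].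
  apply has_sum_finite; [assumption|]. intros x Hx. rewrite Hf; [ring|assumption].
Qed.

Lemma sq_le_has_sum f M :
  sq_le f M -> exists s, has_sum (fun x => f x * f x) s /\ s <= M.
Proof. intros H. apply has_sum_bounded; [intros; nra|exact H]. Qed.

(* Polarization: [4 f g = (f + g)^2 - (f - g)^2]. *)
Lemma has_sum_mul f g A B :
  sq_le f A -> sq_le g B -> exists s, has_sum (fun x => f x * g x) s.
Proof.
  intros Hf Hg.
  destruct (sq_le_has_sum _ _ (sq_le_plus _ _ _ _ Hf Hg)) as (s & Hs & _).
  destruct (sq_le_has_sum _ _ (sq_le_minus _ _ _ _ Hf Hg)) as (t & Ht & _).
  exists (/ 4 * (s - t)).
  apply has_sum_ext with
    (fun x => / 4 * ((f x + g x) * (f x + g x) - (f x - g x) * (f x - g x)));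
    [intros; field|].
  apply has_sum_scal. now apply has_sum_minus.
Qed.

Lemma has_sum_cauchy_schwarz f g A B s :
  sq_le f A -> sq_le g B -> has_sum (fun x => f x * g x) s -> s * s <= A * B.
Proof.
  intros Hf Hg Hs. apply Rnot_lt_le. intros Hlt.
  pose proof (sq_le_nonneg _ _ Hf). pose proof (sq_le_nonneg _ _ Hg).
  set (d := s * s - A * B) in *. assert (Hd : 0 < d) by (unfold d; lra).
  (* Let [e] be this quotient and [t] a partial sum within [e] of [s]. If [e < Rabs s], then
     [(Rabs s - e)^2 < t * t <= A * B] yields [d < 2 * e * Rabs s < d]; otherwise
     [d <= s * s <= e * Rabs s < d]. *)
  assert (He : 0 < d / (2 * Rabs s + 1)).
  { apply Rdiv_lt_0_compat; [assumption|]. pose proof (Rabs_pos s). lra. }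
  destruct (Hs _ He) as [L0 Hc]. destruct (nodup_exists L0) as (L & HL & Hin).
  specialize (Hc L HL (fun x Hx => proj2 (Hin x) Hx)).
  pose proof (lsum_cauchy_schwarz f g L) as HCS.
  specialize (Hf L HL). specialize (Hg L HL).
  pose proof (lsum_sqr_pos f L). pose proof (lsum_sqr_pos g L).
  set (t := lsum (fun x => f x * g x) L) in *.
  assert (Ht : t * t <= A * B).
  { eapply Rle_trans; [apply HCS|]. apply Rmult_le_compat; assumption. }
  set (e := d / (2 * Rabs s + 1)) in *.
  assert (Hed : e * (2 * Rabs s + 1) = d).
  { unfold e. field. pose proof (Rabs_pos s). lra. }
  assert (Rabs s - e < Rabs t).
  { pose proof (Rabs_triang_inv s t). rewrite (Rabs_minus_sym s t) in *. lra. }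
  assert (Es : Rabs s * Rabs s = s * s) by (rewrite <- Rabs_mult; apply Rabs_pos_eq; nra).
  assert (Et : Rabs t * Rabs t = t * t) by (rewrite <- Rabs_mult; apply Rabs_pos_eq; nra).
  pose proof (Rabs_pos s). pose proof (Rabs_pos t).
  destruct (Rle_or_lt (Rabs s) e); unfold d in *; nra.
Qed.

Lemma sq_le_tail f M eps :
  sq_le f M -> 0 < eps ->
  exists K, NoDup K /\ forall L, NoDup L -> (forall x, In x L -> ~ In x K) ->
    lsum (fun x => f x * f x) L <= eps.
Proof.
  intros Hf He. destruct (sq_le_has_sum f M Hf) as (s & Hs & _).
  destruct (Hs eps He) as [L0 H0]. destruct (nodup_exists L0) as (K & HK & Hin).
  exists K. split; [assumption|]. intros L HL Hd.
  specialize (H0 K HK (fun x Hx => proj2 (Hin x) Hx)). apply Rabs_def2 in H0.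
  assert (HN : NoDup (K ++ L)).
  { apply NoDup_app; auto. intros x Hx Hx'. exact (Hd x Hx' Hx). }
  assert (HP := has_sum_partial_le (fun x => f x * f x) s (K ++ L)).
  rewrite lsum_app in HP. cbv beta in HP.
  specialize (HP (fun x => Rle_0_sqr (f x)) Hs HN). lra.
Qed.

Lemma sq_unbounded f M :
  ~ (exists B, sq_le f B) -> exists L, NoDup L /\ M < lsum (fun x => f x * f x) L.
Proof.
  intros H. apply NNPP. intros Hn. apply H. exists M. intros L HL.
  apply Rnot_lt_le. intros Hlt. eauto.
Qed.

(** * Exhaustions by finite sets *)

Definition exhausting (K : nat -> list V) : Prop :=
  (forall n, NoDup (K n)) /\
  forall L, exists N, forall n, (N <= n)%nat -> incl L (K n).

Lemma exhausting_unbounded (K : nat -> list V) f M :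
  exhausting K -> ~ (exists B, sq_le f B) ->
  exists N, forall n, (N <= n)%nat -> M < lsum (fun x => f x * f x) (K n).
Proof.
  intros [HN HK] Hf. destruct (sq_unbounded f M Hf) as (L & HL & HM).
  destruct (HK L) as [N HKN]. exists N. intros n Hn.
  eapply Rlt_le_trans; [apply HM|]. apply lsum_incl_le; auto. intros x. nra.
Qed.

(* The normalized restrictions of a function outside l2 tend weakly to zero. *)
Lemma exhausting_weak_limit (K : nat -> list V) f g M eps :
  exhausting K -> ~ (exists B, sq_le f B) -> sq_le g M -> 0 < eps ->
  exists N, forall n, (N <= n)%nat ->
    lsum (fun x => f x * g x) (K n) * lsum (fun x => f x * g x) (K n)
    <= eps * lsum (fun x => f x * f x) (K n).
Proof.
  intros HK Hf Hg He.
  destruct (sq_le_tail g M (eps / 4) Hg) as (F & HF & Htail); [lra|].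
  set (c := lsum (fun x => f x * g x) F).
  destruct (proj2 HK F) as [N1 HN1].
  (* The threshold makes [c * c <= eps * P / 4] for the part over [F]. Cauchy-Schwarz gives the same
     bound for the part [d] outside [F], and [(c + d)^2 <= 2 * c * c + 2 * d * d]. *)
  destruct (exhausting_unbounded K f (4 * (c * c) / eps) HK Hf) as [N2 HN2].
  exists (max N1 N2). intros n Hn.
  specialize (HN1 n ltac:(lia)). specialize (HN2 n ltac:(lia)).
  destruct (incl_split F (K n) HF HN1) as [R HR].
  pose proof (Permutation_NoDup HR (proj1 HK n)) as HFR.
  assert (HRg : lsum (fun x => g x * g x) R <= eps / 4).
  { apply Htail; [now apply NoDup_app_remove_l in HFR|].
    intros x. now apply NoDup_app_disjoint. }
  pose proof (lsum_cauchy_schwarz f g R) as HCS.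
  rewrite (lsum_perm (fun x => f x * g x) _ _ HR), lsum_app. fold c.
  assert (HRf : lsum (fun x => f x * f x) R <= lsum (fun x => f x * f x) (K n)).
  { rewrite (lsum_perm (fun x => f x * f x) _ _ HR), lsum_app.
    pose proof (lsum_sqr_pos f F). lra. }
  pose proof (lsum_sqr_pos f R). pose proof (lsum_sqr_pos g R).
  set (P := lsum (fun x => f x * f x) (K n)) in *.
  set (d := lsum (fun x => f x * g x) R) in *.
  assert (Hc : 4 * (c * c) <= eps * P).
  { apply Rmult_le_reg_r with (/ eps); [now apply Rinv_0_lt_compat|].
    replace (eps * P * / eps) with P by (field; lra). unfold Rdiv in HN2. lra. }
  assert (Hd : d * d <= P * (eps / 4)).
  { eapply Rle_trans; [apply HCS|]. apply Rmult_le_compat; assumption. }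
  pose proof (Rle_0_sqr (c - d)) as Hcd. unfold Rsqr in Hcd. lra.
Qed.

(** A Fatou argument: on each finite list, [u n] is compared with some [u m] close to [f] there; [m]
    depends on the list, but the resulting bound does not. *)
Lemma sq_conv_cauchy (u : nat -> V -> R) f :
  (forall eps, 0 < eps -> exists N, forall n m, (N <= n)%nat -> (N <= m)%nat ->
     sq_le (fun x => u n x - u m x) eps) ->
  (forall x eps, 0 < eps -> exists N, forall n, (N <= n)%nat ->
     (u n x - f x) * (u n x - f x) <= eps) ->
  sq_conv u f.
Proof.
  intros HC Hp.
  assert (HL : forall L eps, 0 < eps -> exists N, forall n, (N <= n)%nat ->
    lsum (fun x => (u n x - f x) * (u n x - f x)) L <= eps).
  { induction L as [|a L IH]; intros eps He.
    - exists O. intros n _. simpl. lra.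
    - destruct (IH (eps / 2)) as [N1 H1]; [lra|].
      destruct (Hp a (eps / 2)) as [N2 H2]; [lra|].
      exists (max N1 N2). intros n Hn. simpl.
      specialize (H1 n ltac:(lia)). specialize (H2 n ltac:(lia)). lra. }
  intros eps He. destruct (HC (eps / 4)) as [N HN]; [lra|].
  exists N. intros n Hn L HLN. destruct (HL L (eps / 4)) as [N' HN']; [lra|].
  specialize (HN' (max N N') ltac:(lia)).
  specialize (HN n (max N N') Hn ltac:(lia) L HLN). set (m := max N N') in *.
  apply Rle_trans with
    (lsum (fun x => 2 * ((u n x - u m x) * (u n x - u m x))
                    + 2 * ((u m x - f x) * (u m x - f x))) L).
  - apply lsum_le. intros x _.
    pose proof (Rle_0_sqr ((u n x - u m x) - (u m x - f x))) as H.
    unfold Rsqr in H. lra.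
  - rewrite lsum_plus, !lsum_scal. lra.
Qed.

(** * Finitely supported functions *)

Definition fsupp f : Prop := exists L, forall x, ~ In x L -> f x = 0.

Lemma fsupp_nodup f : fsupp f -> exists L, NoDup L /\ forall x, ~ In x L -> f x = 0.
Proof.
  intros [L HL]. destruct (nodup_exists L) as (K & HK & Hin). exists K.
  split; [assumption|]. intros x Hx. apply HL. now rewrite <- Hin.
Qed.

Lemma fsupp_dom f g : (forall x, f x = 0 -> g x = 0) -> fsupp f -> fsupp g.
Proof. intros H [L HL]. exists L. auto. Qed.

Lemma fsupp_minus f g : fsupp f -> fsupp g -> fsupp (fun x => f x - g x).
Proof.
  intros [L HL] [K HK]. exists (L ++ K). intros x Hx. rewrite in_app_iff in Hx.
  rewrite HL, HK by tauto. ring.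
Qed.

Lemma fsupp_sq_le f : fsupp f -> exists M, sq_le f M.
Proof.
  intros Hf. destruct (fsupp_nodup f Hf) as (L & HL & H0).
  eexists. apply sq_le_finite; eassumption.
Qed.

Definition delta (a x : V) : R := if eq_dec x a then 1 else 0.

Lemma fsupp_delta a : fsupp (delta a).
Proof.
  exists (a :: nil). intros x Hx. unfold delta.
  destruct (eq_dec x a); [subst; simpl in Hx; tauto|reflexivity].
Qed.

Lemma has_sum_delta f a : has_sum (fun x => delta a x * f x) (f a).
Proof.
  replace (f a) with (lsum (fun x => delta a x * f x) (a :: nil)).
  - apply has_sum_finite; [repeat constructor; simpl; tauto|].
    intros x Hx. unfold delta.
    destruct (eq_dec x a); [subst; simpl in Hx; tauto|ring].
  - simpl. unfold delta. destruct (eq_dec a a); [ring|congruence].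
Qed.

End Sums.

(** * Weighted adjacency operators *)

Section Hop.
Context {V : Type} (par : V -> V) (ch : V -> list V) (lam : V -> R).
Hypothesis ch_par : forall x y, In y (ch x) <-> par y = x.
Hypothesis ch_nodup : forall x, NoDup (ch x).
Implicit Types (f g : V -> R).

(* [c = 1] is the Jacobi matrix with zero diagonal; [c = -1] is the real
   skew-symmetric matrix obtained from it by conjugating with [i ^ level]. *)
Definition hop (c : R) f (x : V) : R :=
  lam x * f (par x) + c * lsum (fun y => lam y * f y) (ch x).

Lemma hop_lin c a b f g x :
  hop c (fun y => a * f y + b * g y) x = a * hop c f x + b * hop c g x.
Proof.
  unfold hop.
  rewrite (lsum_ext _ (fun y => a * (lam y * f y) + b * (lam y * g y)))
    by (intros; ring).
  rewrite lsum_plus, !lsum_scal. ring.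
Qed.

Lemma hop_ext c f g x : (forall y, f y = g y) -> hop c f x = hop c g x.
Proof.
  intros H. unfold hop. rewrite H, (lsum_ext _ (fun y => lam y * g y)); [reflexivity|].
  intros y _. now rewrite H.
Qed.

Lemma hop_minus c f g x : hop c (fun y => f y - g y) x = hop c f x - hop c g x.
Proof.
  rewrite (hop_ext c _ (fun y => 1 * f y + (-1) * g y)) by (intros; ring).
  rewrite hop_lin. ring.
Qed.

Lemma fsupp_hop c f : fsupp f -> fsupp (hop c f).
Proof.
  intros [L HL]. exists (flat_map ch L ++ map par L). intros x Hx.
  rewrite in_app_iff, in_flat_map, in_map_iff in Hx. unfold hop.
  rewrite HL, lsum_zero; [ring| |].
  - intros y Hy. rewrite HL; [ring|]. intros Hy'. apply Hx. right.
    exists y. split; [now apply ch_par|assumption].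
  - intros Hp. apply Hx. left. exists (par x). split; [assumption|now apply ch_par].
Qed.

Lemma nodup_fibers L : NoDup L -> NoDup (flat_map ch L).
Proof.
  induction 1 as [|a L Ha HL IH]; simpl; [constructor|].
  apply NoDup_app; auto. intros y Hy Hy'. apply ch_par in Hy.
  apply in_flat_map in Hy'. destruct Hy' as (b & Hb & Hyb).
  apply ch_par in Hyb. congruence.
Qed.

(** Each vertex occurs in exactly one list of children, that of its parent, so the sum may be
    grouped by parents. *)
Lemma has_sum_fibers f L :
  NoDup L -> (forall x, ~ In x L -> f x = 0) ->
  has_sum (fun x => lsum f (ch x)) (lsum f L).
Proof.
  intros HL Hf eps He. exists (map par L). intros K HK Hi.
  rewrite <- lsum_flat_map, (lsum_supp f L).
  - rewrite Rminus_diag, Rabs_R0. assumption.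
  - assumption.
  - now apply nodup_fibers.
  - intros x Hx. apply in_flat_map. exists (par x).
    split; [apply Hi; now apply in_map|now apply ch_par].
  - assumption.
Qed.

(** Summation by parts over the edges. An edge from [y] to its parent contributes [F y] or [G y],
    according to the endpoint at which [u] is evaluated; the two sums are [G + c * F] and
    [F + c * G], which differ by the factor [c] because [c * c = 1]. Finite support of [u] allows
    any [f]. *)
Lemma hop_parts c u f :
  c * c = 1 -> fsupp u ->
  exists s, has_sum (fun x => hop c u x * f x) s /\
            has_sum (fun x => u x * hop c f x) (c * s).
Proof.
  intros Hc Hu. destruct (fsupp_nodup u Hu) as (L & HL & Hu0).
  set (F := fun y => lam y * u y * f (par y)).
  set (G := fun y => lam y * u (par y) * f y).
  assert (HF : forall x, ~ In x L -> F x = 0).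
  { intros x Hx. unfold F. rewrite Hu0 by assumption. ring. }
  assert (HG : forall x, ~ In x (flat_map ch L) -> G x = 0).
  { intros x Hx. unfold G. rewrite Hu0; [ring|]. intros Hp. apply Hx.
    apply in_flat_map. exists (par x). split; [assumption|now apply ch_par]. }
  pose proof (nodup_fibers L HL) as HGN.
  exists (lsum G (flat_map ch L) + c * lsum F L). split.
  - apply has_sum_ext with (fun x => G x + c * lsum F (ch x)).
    + intros x. unfold hop, G.
      rewrite (lsum_ext F (fun y => f x * (lam y * u y))).
      * rewrite lsum_scal. ring.
      * intros y Hy. apply ch_par in Hy. unfold F. rewrite Hy. ring.
    + apply has_sum_plus; [now apply has_sum_finite|].
      apply has_sum_scal. now apply has_sum_fibers.
  - replace (c * (lsum G (flat_map ch L) + c * lsum F L))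
      with (lsum F L + c * lsum G (flat_map ch L))
      by (transitivity (c * c * lsum F L + c * lsum G (flat_map ch L));
          [rewrite Hc|]; ring).
    apply has_sum_ext with (fun x => F x + c * lsum G (ch x)).
    + intros x. unfold hop, F.
      rewrite (lsum_ext G (fun y => u x * (lam y * f y))).
      * rewrite lsum_scal. ring.
      * intros y Hy. apply ch_par in Hy. unfold G. rewrite Hy. ring.
    + apply has_sum_plus; [now apply has_sum_finite|].
      apply has_sum_scal. now apply has_sum_fibers.
Qed.

(** Summation by parts survives the limit in the graph norm, since both pairings are continuous by
    Cauchy-Schwarz. *)
Lemma hop_parts_closure c (u : nat -> V -> R) a z f A Z M N :
  c * c = 1 -> (forall n, fsupp (u n)) -> sq_conv u a ->
  sq_conv (fun n => hop c (u n)) z ->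
  sq_le a A -> sq_le z Z -> sq_le f M -> sq_le (hop c f) N ->
  exists s, has_sum (fun x => z x * f x) s /\
            has_sum (fun x => a x * hop c f x) (c * s).
Proof.
  intros Hc Hu Ha Hz HA HZ HM HN.
  destruct (has_sum_mul z f Z M HZ HM) as [s Hs].
  destruct (has_sum_mul a (hop c f) A N HA HN) as [t Ht].
  exists s. split; [assumption|]. replace (c * s) with t; [assumption|].
  assert (HcR : Rabs c = 1).
  { unfold Rabs. destruct Rcase_abs; nra. }
  pose proof (sq_le_nonneg _ _ HM). pose proof (sq_le_nonneg _ _ HN).
  apply NNPP. intros Hne. set (d := Rabs (t - c * s)).
  assert (Hd : 0 < d) by (apply Rabs_pos_lt; lra).
  (* The errors satisfy [(c * r - t)^2 <= e * N] and [(c * r - c * s)^2 <= e * M], hence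
     [d * d <= 2 * e * (M + N)], which this [e] makes smaller than [d * d]. *)
  set (e := d * d / (8 * (M + N + 1))).
  assert (He : 0 < e) by (apply Rdiv_lt_0_compat; nra).
  destruct (Ha e He) as [N1 H1]. destruct (Hz e He) as [N2 H2].
  specialize (H1 (max N1 N2) ltac:(lia)). specialize (H2 (max N1 N2) ltac:(lia)).
  set (n := max N1 N2) in *. cbv beta in H1, H2.
  destruct (hop_parts c (u n) f Hc (Hu n)) as (r & Hr & Hr').
  assert (E1 : (c * r - t) * (c * r - t) <= e * N).
  { apply (has_sum_cauchy_schwarz (fun x => u n x - a x) (hop c f)); auto.
    apply has_sum_ext with (fun x => u n x * hop c f x - a x * hop c f x);
      [intros; ring|]. now apply has_sum_minus. }
  assert (E2 : (r - s) * (r - s) <= e * M).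
  { apply (has_sum_cauchy_schwarz (fun x => hop c (u n) x - z x) f); auto.
    apply has_sum_ext with (fun x => hop c (u n) x * f x - z x * f x);
      [intros; ring|]. now apply has_sum_minus. }
  assert (E3 : d * d = (t - c * s) * (t - c * s)).
  { unfold d. rewrite <- Rabs_mult. apply Rabs_pos_eq. apply Rle_0_sqr. }
  assert (E4 : (c * r - c * s) * (c * r - c * s) <= e * M).
  { replace ((c * r - c * s) * (c * r - c * s)) with (c * c * ((r - s) * (r - s)))
      by ring. rewrite Hc. lra. }
  assert (E5 : e * (8 * (M + N + 1)) = d * d) by (unfold e; field; lra).
  pose proof (Rle_0_sqr ((c * r - t) + (c * r - c * s))) as E6. unfold Rsqr in E6.
  nra.
Qed.

(** Pairing the limits with [delta x] and moving [hop] across twice identifies [z x]. *)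
Lemma hop_closed c (u : nat -> V -> R) a z A Z x :
  c * c = 1 -> (forall n, fsupp (u n)) -> sq_conv u a ->
  sq_conv (fun n => hop c (u n)) z -> sq_le a A -> sq_le z Z ->
  z x = hop c a x.
Proof.
  intros Hc Hu Ha Hz HA HZ. pose proof (fsupp_delta x) as Hd.
  destruct (fsupp_sq_le _ Hd) as [M HM].
  destruct (fsupp_sq_le _ (fsupp_hop c _ Hd)) as [N HN].
  destruct (hop_parts_closure c u a z (delta x) A Z M N) as (s & Hs & Hs'); auto.
  destruct (hop_parts c (delta x) a Hc Hd) as (t & Ht & Ht').
  assert (E1 : z x = s).
  { apply (has_sum_unique (fun y => z y * delta x y)); [|assumption].
    apply has_sum_ext with (fun y => delta x y * z y); [intros; ring|].
    apply has_sum_delta. }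
  assert (E2 : c * s = t).
  { apply (has_sum_unique (fun y => a y * hop c (delta x) y)); [assumption|].
    apply has_sum_ext with (fun y => hop c (delta x) y * a y); [intros; ring|].
    assumption. }
  assert (E3 : hop c a x = c * t).
  { apply (has_sum_unique (fun y => delta x y * hop c a y)); [|assumption].
    apply has_sum_delta. }
  rewrite E3, <- E2, <- Rmult_assoc, Hc, E1. ring.
Qed.

(* Skew symmetry makes [<u, hop (-1) u> = 0]. *)
Lemma skew_coercive u M :
  fsupp u -> sq_le (fun x => hop (-1) u x - u x) M -> sq_le u M.
Proof.
  intros Hu HM.
  destruct (hop_parts (-1) u u) as (s & Hs & Hs'); [ring|assumption|].
  assert (E : s = -1 * s).
  { apply (has_sum_unique (fun x => hop (-1) u x * u x)); [assumption|].
    apply has_sum_ext with (fun x => u x * hop (-1) u x); [intros; ring|assumption]. }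
  destruct (fsupp_sq_le u Hu) as [U HU].
  destruct (sq_le_has_sum u U HU) as (t & Ht & _).
  destruct (sq_le_has_sum _ M HM) as (r & Hr & Hle).
  (* Expanding the squared norm of [hop (-1) u] as that of [(hop (-1) u - u) + u] gives
     [r + 2 * s - t] with [s = 0]; being nonnegative, it forces [t <= r]. *)
  assert (Htr : has_sum (fun x => hop (-1) u x * hop (-1) u x) (r + 2 * s - t)).
  { apply has_sum_ext with
      (fun x => (hop (-1) u x - u x) * (hop (-1) u x - u x)
                + 2 * (hop (-1) u x * u x) - u x * u x); [intros; ring|].
    apply has_sum_minus; [|assumption].
    apply has_sum_plus; [assumption|]. now apply has_sum_scal. }
  assert (0 <= r + 2 * s - t).
  { apply (has_sum_partial_le _ _ nil (fun x => Rle_0_sqr (hop (-1) u x)) Htr).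
    constructor. }
  intros L HL. apply Rle_trans with t; [|lra].
  apply has_sum_partial_le; auto. intros x. apply Rle_0_sqr.
Qed.

End Hop.

(** * Leveled trees *)

Section Tree.
Context {V : Type} (lev : V -> nat) (par : V -> V) (ch : V -> list V) (lam : V -> R).
Hypothesis tree : leveled_tree lev par ch.
Hypothesis lam_pos : forall x, 0 < lam x.
Variable xs : nat -> V.
Hypothesis lev_xs : forall n, lev (xs n) = n.
Hypothesis par_xs : forall n, par (xs n) = xs (S n).

Lemma lev_par x : lev (par x) = S (lev x).
Proof. apply tree. Qed.

Lemma tree_ch_par x y : In y (ch x) <-> par y = x.
Proof. apply tree. Qed.

Lemma tree_ch_nodup x : NoDup (ch x).
Proof. apply tree. Qed.

Lemma lev_iter k x : lev (Nat.iter k par x) = (lev x + k)%nat.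
Proof. induction k as [|k IH]; simpl; [lia|]. rewrite lev_par, IH. lia. Qed.

Lemma iter_xs k n : Nat.iter k par (xs n) = xs (n + k).
Proof.
  induction k as [|k IH]; simpl; [now rewrite Nat.add_0_r|].
  now rewrite IH, par_xs, Nat.add_succ_r.
Qed.

(** Induction on a chain of adjacent vertices; two ancestor relations through [y] are merged by
    climbing further, as iterates of [par] commute. *)
Lemma common_ancestor x y : exists m k, Nat.iter m par x = Nat.iter k par y.
Proof.
  destruct tree as (_ & _ & _ & _ & Hconn).
  induction (Hconn x y) as [x y [->| ->]|x|x y z _ (m & k & E) _ (m' & k' & E')].
  - now exists 1%nat, O.
  - now exists O, 1%nat.
  - now exists O, O.
  - exists (m' + m)%nat, (k + k')%nat.
    rewrite Nat.iter_add, E, <- Nat.iter_add, Nat.add_comm, Nat.iter_add, E'.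
    now rewrite <- Nat.iter_add.
Qed.

(** A common ancestor with [xs 0] lies on the path, and its level determines its index. *)
Lemma reaches_path x : exists m, Nat.iter m par x = xs (lev x + m).
Proof.
  destruct (common_ancestor x (xs 0)) as (m & k & E). exists m. rewrite E.
  assert (Hl := f_equal lev E). rewrite !lev_iter, lev_xs in Hl.
  rewrite iter_xs. f_equal. lia.
Qed.

Definition below (z x : V) : Prop := exists k, Nat.iter k par x = z.

Lemma below_finite z : exists L, NoDup L /\ forall x, In x L <-> below z x.
Proof.
  (* The subtree of [z] consists of [z] and the subtrees of its finitely many children, which lie
     one level lower. *)
  assert (H : forall n z, (lev z < n)%nat -> exists L, forall x, below z x -> In x L).
  { clear z. induction n as [|n IH]; intros z Hz; [lia|].
    assert (HL : forall l, incl l (ch z) ->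
      exists L, forall x y, In y l -> below y x -> In x L).
    { induction l as [|y l IHl]; intros Hi; [now exists nil|].
      destruct IHl as [L HL]; [intros t Ht; apply Hi; now right|].
      destruct (IH y) as [L' HL'].
      - assert (Hy : par y = z) by (apply tree_ch_par, Hi; now left).
        rewrite <- Hy, lev_par in Hz. lia.
      - exists (L' ++ L). intros x t [<-|Ht] Hx; apply in_or_app; eauto. }
    destruct (HL (ch z) (incl_refl _)) as [L HLz]. exists (z :: L).
    intros x [[|k] E]; [now left|]. right.
    apply HLz with (Nat.iter k par x); [now apply tree_ch_par|now exists k]. }
  destruct (H (S (lev z)) z) as [L HL]; [lia|].
  destruct (nodup_exists L) as (K & HK & Hin).
  exists (filter (fun x => if excluded_middle_informative (below z x)
                           then true else false) K).
  split; [now apply NoDup_filter|]. intros x. rewrite filter_In.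
  destruct excluded_middle_informative as [Hb|Hb]; split; intros Hx;
    try tauto; try (now destruct Hx); auto.
  split; [|reflexivity]. apply Hin, HL, Hb.
Qed.

(** * The positive solution *)

(** The argument [k] stands for the level of [x] and makes the descent to the children
    structural. *)
Fixpoint ratio_aux (k : nat) (x : V) : R :=
  match k with
  | O => / lam x
  | S k' => (1 + lsum (fun y => lam y / ratio_aux k' y) (ch x)) / lam x
  end.

(* [p (par x) / p x] for a solution of [hop (-1) p = p]. *)
Definition ratio (x : V) : R := ratio_aux (lev x) x.

Lemma ratio_pos x : 0 < ratio x.
Proof.
  unfold ratio. generalize (lev x). intros k. revert x.
  induction k as [|k IH]; intros x; simpl; [now apply Rinv_0_lt_compat|].
  apply Rdiv_lt_0_compat; [|apply lam_pos].
  assert (0 <= lsum (fun y => lam y / ratio_aux k y) (ch x)); [|lra].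
  apply lsum_pos. intros y _. left. apply Rdiv_lt_0_compat; auto.
Qed.

(** This is [hop (-1) p = p] at [x] divided by [p x]: for a child [y], [p y / p x] is
    [/ ratio y]. *)
Lemma ratio_rec x : lam x * ratio x = 1 + lsum (fun y => lam y / ratio y) (ch x).
Proof.
  pose proof (lam_pos x). unfold ratio at 1. destruct (lev x) as [|k] eqn:E; simpl.
  - rewrite lsum_zero; [field; lra|]. intros y Hy. apply tree_ch_par in Hy.
    rewrite <- Hy, lev_par in E. discriminate.
  - rewrite (lsum_ext _ (fun y => lam y / ratio y)); [field; lra|].
    intros y Hy. apply tree_ch_par in Hy. rewrite <- Hy, lev_par in E.
    injection E as <-. reflexivity.
Qed.

(** The telescoping product for the quotient of [p] at the ancestor [m] steps up by [p x]. *)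
Fixpoint ratio_prod (x : V) (m : nat) : R :=
  match m with O => 1 | S m' => ratio (Nat.iter m' par x) * ratio_prod x m' end.

Lemma ratio_prod_pos x m : 0 < ratio_prod x m.
Proof.
  induction m as [|m IH]; simpl; [lra|]. apply Rmult_lt_0_compat; [apply ratio_pos|apply IH].
Qed.

Lemma ratio_prod_par x m : ratio_prod x (S m) = ratio x * ratio_prod (par x) m.
Proof.
  induction m as [|m IH]; [reflexivity|].
  change (ratio_prod x (S (S m))) with (ratio (Nat.iter (S m) par x) * ratio_prod x (S m)).
  rewrite IH, Nat.iter_succ_r. simpl. ring.
Qed.

(** Above the point where the ancestors of [x] join the path, numerator and denominator gain the
    same factors. *)
Lemma ratio_prod_indep x m d :
  Nat.iter m par x = xs (lev x + m) ->
  ratio_prod (xs 0) (lev x + (d + m)) / ratio_prod x (d + m)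
  = ratio_prod (xs 0) (lev x + m) / ratio_prod x m.
Proof.
  intros E. induction d as [|d IH]; [reflexivity|]. rewrite <- IH.
  rewrite Nat.add_succ_l, Nat.add_succ_r. simpl.
  rewrite iter_xs, Nat.iter_add, E, iter_xs.
  replace (lev x + m + d)%nat with (0 + (lev x + (d + m)))%nat by lia.
  pose proof (ratio_pos (xs (0 + (lev x + (d + m))))).
  pose proof (ratio_prod_pos x (d + m)). field. lra.
Qed.

(** The prescribed ratios determine [p] up to a factor; normalized to 1 at [xs 0], its value at [x]
    is found by climbing the path to a common ancestor and descending to [x]. *)
Lemma positive_solution :
  exists p, (forall x, 0 < p x) /\ forall x, hop par ch lam (-1) p x = p x.
Proof.
  set (m x := proj1_sig (constructive_indefinite_description _ (reaches_path x))).
  assert (Hm : forall x, Nat.iter (m x) par x = xs (lev x + m x)).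
  { intros x. unfold m. now destruct constructive_indefinite_description. }
  set (p x := ratio_prod (xs 0) (lev x + m x) / ratio_prod x (m x)).
  assert (Hp : forall x k, Nat.iter k par x = xs (lev x + k) ->
    p x = ratio_prod (xs 0) (lev x + k) / ratio_prod x k).
  { intros x k E. unfold p.
    rewrite <- (ratio_prod_indep x (m x) k (Hm x)).
    rewrite <- (ratio_prod_indep x k (m x) E). now rewrite Nat.add_comm with k (m x). }
  assert (Hpar : forall x, p (par x) = ratio x * p x).
  { intros x. rewrite (Hp x (S (m (par x)))).
    - unfold p. rewrite ratio_prod_par, lev_par, Nat.add_succ_r, Nat.add_succ_l.
      field. pose proof (ratio_pos x). pose proof (ratio_prod_pos (par x) (m (par x))).
      lra.
    - rewrite Nat.iter_succ_r, Hm, lev_par. f_equal. lia. }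
  assert (Hpos : forall x, 0 < p x).
  { intros x. apply Rdiv_lt_0_compat; apply ratio_prod_pos. }
  exists p. split; [assumption|]. intros x. unfold hop.
  rewrite Hpar, <- Rmult_assoc, ratio_rec.
  rewrite (lsum_ext (fun y => lam y * p y) (fun y => p x * (lam y / ratio y))).
  - rewrite lsum_scal. ring.
  - intros y Hy. apply tree_ch_par in Hy. rewrite <- Hy, Hpar. field.
    pose proof (ratio_pos y). lra.
Qed.

(** * Multiplication by functions of the level *)

(** The parent and the children of [x] differ by two levels, so [s] takes opposite values on them
    and the symmetric matrix becomes the skew one. Real and imaginary parts of [i ^ n] are such
    sequences. *)
Lemma hop_gauge (s : nat -> R) f x :
  (forall n, s (S (S n)) = - s n) ->
  hop par ch lam 1 (fun y => s (lev y) * f y) x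
  = s (S (lev x)) * hop par ch lam (-1) f x.
Proof.
  intros Hs. unfold hop. rewrite lev_par.
  rewrite (lsum_ext _ (fun y => - s (S (lev x)) * (lam y * f y))).
  - rewrite lsum_scal. ring.
  - intros y Hy. apply tree_ch_par in Hy. rewrite <- Hy, lev_par, Hs. ring.
Qed.

(** Every edge changes the parity of the level, so the alternating sign anticommutes with [hop]. *)
Lemma hop_alternate f x :
  hop par ch lam (-1) (fun y => (-1) ^ lev y * f y) x
  = - (-1) ^ lev x * hop par ch lam (-1) f x.
Proof.
  unfold hop. rewrite lev_par. simpl.
  rewrite (lsum_ext _ (fun y => - (-1) ^ lev x * (lam y * f y))).
  - rewrite lsum_scal. ring.
  - intros y Hy. apply tree_ch_par in Hy. rewrite <- Hy, lev_par. simpl. ring.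
Qed.

(** * Approximation in the graph norm when the positive solution is not in l2 *)

Section Approximation.
Variable p : V -> R.
Hypothesis p_pos : forall x, 0 < p x.
Hypothesis p_eq : forall x, hop par ch lam (-1) p x = p x.

Let B := hop par ch lam (-1).
Let r x := (-1) ^ lev x * p x.

Lemma r_sqr x : r x * r x = p x * p x.
Proof.
  unfold r. transitivity ((-1) ^ lev x * (-1) ^ lev x * (p x * p x)); [ring|].
  rewrite <- Rpow_mult_distr. replace (-1 * -1) with 1 by ring. rewrite pow1. ring.
Qed.

Lemma r_eq x : B r x = - r x.
Proof. unfold B, r. rewrite hop_alternate, p_eq. ring. Qed.

(* The subtraction of [c * p] makes the truncated function vanish at
   [xs (S n)]; the value of [B u - u] there is then forced by orthogonality to
   the adjoint solution [r]. *)
Lemma truncated_solution f n L :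
  let K := xs (S n) :: L in
  let alpha := lsum (fun x => r x * (B f x - f x)) K / lsum (fun x => r x * r x) K in
  NoDup L -> (forall x, In x L <-> below (xs n) x) ->
  exists u c,
    (forall x, In x L -> u x = f x + alpha / 2 * r x - c * p x) /\
    (forall x, ~ In x L -> u x = 0) /\
    (forall x, In x K -> B u x - u x = B f x - f x - alpha * r x) /\
    (forall x, ~ In x K -> B u x - u x = 0).
Proof.
  intros K alpha HL Hin. pose proof (p_pos (xs (S n))) as Hp.
  set (c := (f (xs (S n)) + alpha / 2 * r (xs (S n))) / p (xs (S n))).
  set (phi x := f x + alpha / 2 * r x - c * p x).
  set (u x := if in_dec eq_dec x L then phi x else 0).
  assert (u_in : forall x, In x L -> u x = phi x).
  { intros x Hx. unfold u. destruct in_dec; tauto. }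
  assert (u_out : forall x, ~ In x L -> u x = 0).
  { intros x Hx. unfold u. destruct in_dec; tauto. }
  assert (top : ~ In (xs (S n)) L).
  { rewrite Hin. intros [k E]. apply (f_equal lev) in E.
    rewrite lev_iter, !lev_xs in E. lia. }
  assert (phi_top : phi (xs (S n)) = 0) by (unfold phi, c; field; lra).
  assert (down : forall x, In (par x) L -> In x L).
  { intros x. rewrite !Hin. intros [k E]. exists (S k). now rewrite Nat.iter_succ_r. }
  assert (up : forall x, In x L -> par x = xs (S n) \/ In (par x) L).
  { intros x. rewrite !Hin. intros [[|k] E].
    - left. simpl in E. now rewrite E.
    - right. exists k. now rewrite <- Nat.iter_succ_r. }
  (* Since [(B - 1) r = - 2 r] and [(B - 1) p = 0], the coefficient [alpha / 2] produces exactly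
     [- alpha * r]. *)
  assert (phi_eq : forall x, B phi x - phi x = B f x - f x - alpha * r x).
  { intros x. unfold B, phi.
    rewrite (hop_ext _ _ _ _ _ (fun y => 1 * (1 * f y + alpha / 2 * r y) + (- c) * p y))
      by (intros; ring).
    rewrite hop_lin, hop_lin, p_eq. change (hop par ch lam (-1) r x) with (B r x).
    rewrite r_eq. lra. }
  (* The only neighbour of [L] outside [L] is [xs (S n)], where [phi] vanishes, so truncation
     changes nothing inside [L]. *)
  assert (u_L : forall x, In x L -> B u x - u x = B f x - f x - alpha * r x).
  { intros x Hx. rewrite <- phi_eq, u_in by assumption. f_equal. unfold B, hop.
    rewrite (lsum_ext _ (fun y => lam y * phi y)).
    - destruct (up x Hx) as [E|E]; [|now rewrite u_in].
      now rewrite E, phi_top, u_out.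
    - intros y Hy. rewrite u_in; [reflexivity|]. apply down.
      apply tree_ch_par in Hy. now rewrite Hy. }
  assert (u_off : forall x, ~ In x K -> B u x - u x = 0).
  { intros x Hx. unfold K in Hx. simpl in Hx. rewrite (u_out x) by tauto.
    unfold B, hop. rewrite u_out, lsum_zero; [ring| |auto].
    intros y Hy. apply tree_ch_par in Hy. rewrite u_out; [ring|].
    intros HyL. destruct (up y HyL) as [E|E]; rewrite Hy in E; [|tauto].
    apply Hx. left. congruence. }
  exists u, c. split; [exact u_in|]. split; [exact u_out|]. split; [|exact u_off].
  (* At [xs (S n)]: both [B u - u] and [B f - f - alpha * r] are orthogonal to [r] over [K], the
     first by [B r = - r] and skew symmetry ([E]), the second by the choice of [alpha] ([F]). They
     agree on [L] and [r] is nonzero at [xs (S n)], so they agree there too. *)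
  intros x [<-|Hx]; [|now apply u_L].
  destruct (hop_parts par ch lam tree_ch_par tree_ch_nodup (-1) u r)
    as (s & Hs & Hs'); [ring|now exists L|].
  assert (HK : NoDup K) by now constructor.
  assert (E : lsum (fun x => r x * (B u x - u x)) K = s - s).
  { apply (has_sum_unique (fun x => r x * (B u x - u x))).
    - apply has_sum_finite; [assumption|]. intros x Hx. rewrite u_off by assumption. ring.
    - apply has_sum_ext with
        (fun x => B u x * r x - (-1) * (u x * B r x)).
      + intros x. rewrite r_eq. ring.
      + apply has_sum_minus; [exact Hs|].
        replace s with (-1 * (-1 * s)) at 1 by ring. now apply has_sum_scal. }
  assert (Q : 0 < lsum (fun x => r x * r x) K).
  { unfold K. simpl. pose proof (lsum_sqr_pos r L). rewrite r_sqr. nra. }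
  assert (F : lsum (fun x => r x * (B f x - f x - alpha * r x)) K = 0).
  { rewrite (lsum_ext _ (fun x => r x * (B f x - f x) + (- alpha) * (r x * r x)))
      by (intros; ring).
    rewrite lsum_plus, lsum_scal. unfold alpha. field. lra. }
  unfold K in E, F. simpl in E, F.
  rewrite (lsum_ext _ (fun x => r x * (B f x - f x - alpha * r x)) L) in E
    by (intros x Hx; now rewrite u_L).
  apply Rmult_eq_reg_l with (r (xs (S n))); [lra|].
  intros E0. pose proof (r_sqr (xs (S n))) as E1. rewrite E0 in E1. nra.
Qed.

(** The maximal operator is the closure of the operator on finitely supported functions. First
    [(B - 1) u n] is shown to converge, coercivity then makes [u n] Cauchy, and the growth of [p]
    identifies its limit as [f]. *)
Lemma sq_approximation f M N :
  ~ (exists A, sq_le p A) -> sq_le f M -> sq_le (B f) N ->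
  exists u : nat -> V -> R, (forall n, fsupp (u n)) /\
    sq_conv u f /\ sq_conv (fun n => B (u n)) (B f).
Proof.
  intros Hp HM HN.
  assert (Hr : ~ (exists A, sq_le r A)).
  { intros [A HA]. apply Hp. exists A. apply sq_le_dom with r; [|assumption].
    intros x. rewrite r_sqr. lra. }
  set (g x := B f x - f x).
  assert (Hg : sq_le g (2 * N + 2 * M)) by now apply sq_le_minus.
  set (L n := proj1_sig (constructive_indefinite_description _ (below_finite (xs n)))).
  assert (HL : forall n, NoDup (L n) /\ forall x, In x (L n) <-> below (xs n) x).
  { intros n. unfold L. now destruct constructive_indefinite_description. }
  set (K n := xs (S n) :: L n).
  set (P n := lsum (fun x => r x * r x) (K n)).
  set (alpha n := lsum (fun x => r x * g x) (K n) / P n).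
  assert (Hu : exists uc : nat -> (V -> R) * R, forall n,
    (forall x, In x (L n) ->
       fst (uc n) x = f x + alpha n / 2 * r x - snd (uc n) * p x) /\
    (forall x, ~ In x (L n) -> fst (uc n) x = 0) /\
    (forall x, In x (K n) -> B (fst (uc n)) x - fst (uc n) x = g x - alpha n * r x) /\
    (forall x, ~ In x (K n) -> B (fst (uc n)) x - fst (uc n) x = 0)).
  { assert (Hn : forall n, exists uc : (V -> R) * R,
      (forall x, In x (L n) -> fst uc x = f x + alpha n / 2 * r x - snd uc * p x) /\
      (forall x, ~ In x (L n) -> fst uc x = 0) /\
      (forall x, In x (K n) -> B (fst uc) x - fst uc x = g x - alpha n * r x) /\
      (forall x, ~ In x (K n) -> B (fst uc) x - fst uc x = 0)).
    2:{ exists (fun n => proj1_sig (constructive_indefinite_description _ (Hn n))).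
        intros n. now destruct constructive_indefinite_description. }
    intros n.
    destruct (truncated_solution f n (L n)) as (u & c & H); [apply HL|apply HL|].
    now exists (u, c). }
  destruct Hu as [uc Huc].
  set (u n := fst (uc n)). set (c n := snd (uc n)).
  assert (HKN : forall n, NoDup (K n)).
  { intros n. constructor; [|apply HL]. rewrite (proj2 (HL n)). intros [k E].
    apply (f_equal lev) in E. rewrite lev_iter, !lev_xs in E. lia. }
  assert (HLE : exhausting L).
  { split; [intros n; apply HL|]. intros F. induction F as [|a F [n0 IH]].
    - exists O. intros n _ x [].
    - destruct (reaches_path a) as [m E]. exists (max n0 (lev a + m)).
      intros n Hn x [<-|Hx].
      + apply (proj2 (HL n)). exists (n - (lev a + m) + m)%nat.
        rewrite Nat.iter_add, E, iter_xs. f_equal. lia.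
      + apply (IH n); [lia|assumption]. }
  assert (HKE : exhausting K).
  { split; [assumption|]. intros F. destruct (proj2 HLE F) as [n0 H0].
    exists n0. intros n Hn x Hx. right. now apply (H0 n). }
  assert (HP : forall n, 0 < P n).
  { intros n. unfold P, K. simpl. rewrite r_sqr. pose proof (p_pos (xs (S n))).
    pose proof (lsum_sqr_pos r (L n)). nra. }
  (* [alpha n * alpha n * P n] is the squared norm of the projection of [g] on [r] over [K n], which
     tends to zero by the weak limit. *)
  assert (Halpha : forall eps, 0 < eps -> exists n0, forall n, (n0 <= n)%nat ->
    alpha n * alpha n * P n <= eps).
  { intros eps He.
    destruct (exhausting_weak_limit K r g _ eps HKE Hr Hg He) as [n0 H0].
    exists n0. intros n Hn. specialize (H0 n Hn). fold (P n) in H0.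
    specialize (HP n). unfold alpha.
    set (q := lsum (fun x => r x * g x) (K n)) in *.
    replace (q / P n * (q / P n) * P n) with (q * q * / P n) by (field; lra).
    apply Rmult_le_reg_r with (P n); [assumption|].
    rewrite Rmult_assoc, Rinv_l by lra. lra. }
  assert (Halpha_r : forall n,
    sq_le (fun x => if in_dec eq_dec x (K n) then alpha n * r x else 0)
          (alpha n * alpha n * P n)).
  { intros n. unfold P.
    rewrite <- lsum_scal,
      (lsum_ext _ (fun x => (if in_dec eq_dec x (K n) then alpha n * r x else 0) *
                            (if in_dec eq_dec x (K n) then alpha n * r x else 0))).
    - apply sq_le_finite; [apply HKN|]. intros x Hx. destruct in_dec; tauto.
    - intros x Hx. destruct in_dec; [ring|tauto]. }
  (* The error is [- alpha n * r] on [K n] and [- g] outside it: a vanishing projection and a tail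
     of [g]. *)
  assert (Hres : forall eps, 0 < eps -> exists n0, forall n, (n0 <= n)%nat ->
    sq_le (fun x => B (u n) x - u n x - g x) eps).
  { intros eps He. destruct (Halpha (eps / 4)) as [n1 H1]; [lra|].
    destruct (sq_le_tail g _ (eps / 4) Hg) as (F & HF & Htail); [lra|].
    destruct (proj2 HKE F) as [n2 H2]. exists (max n1 n2). intros n Hn.
    specialize (H1 n ltac:(lia)). specialize (H2 n ltac:(lia)).
    assert (Ht : sq_le (fun x => if in_dec eq_dec x (K n) then 0 else g x) (eps / 4)).
    { intros l Hl.
      set (b x := if in_dec eq_dec x (K n) then false else true).
      rewrite (lsum_ext _ (fun x => if b x then g x * g x else 0)).
      - rewrite <- lsum_filter. apply Htail; [now apply NoDup_filter|].
        intros x Hx HxF. apply filter_In in Hx. destruct Hx as [_ Hb].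
        unfold b in Hb. destruct in_dec as [|Hnk]; [discriminate|]. now apply Hnk, H2.
      - intros x _. unfold b. destruct in_dec; ring. }
    apply sq_le_weaken with (2 * (alpha n * alpha n * P n) + 2 * (eps / 4)); [lra|].
    eapply sq_le_dom; [|exact (sq_le_plus _ _ _ _ (Halpha_r n) Ht)].
    intros x. cbv beta. destruct (Huc n) as (_ & _ & Hin & Hout).
    destruct in_dec as [Hx|Hx]; unfold u; [rewrite Hin|rewrite Hout]; auto; lra. }
  assert (Hfs : forall n, fsupp (u n)).
  { intros n. exists (L n). apply Huc. }
  assert (Hcauchy : forall eps, 0 < eps -> exists n0, forall n m,
    (n0 <= n)%nat -> (n0 <= m)%nat -> sq_le (fun x => u n x - u m x) eps).
  { intros eps He. destruct (Hres (eps / 4)) as [n0 H0]; [lra|].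
    exists n0. intros n m Hn Hm.
    apply (skew_coercive par ch lam tree_ch_par tree_ch_nodup);
      [now apply fsupp_minus|].
    apply sq_le_weaken with (2 * (eps / 4) + 2 * (eps / 4)); [lra|].
    eapply sq_le_dom; [|exact (sq_le_minus _ _ _ _ (H0 n Hn) (H0 m Hm))].
    intros x. cbv beta. rewrite hop_minus. fold B. lra. }
  (* On [L n], [c n * p] equals [f + alpha n / 2 * r - u n], and all three terms are bounded in l2.
     As the norm of [p] over [L n] is unbounded, [alpha n] and [c n] must tend to zero. *)
  assert (Hbound : exists C n0, forall n, (n0 <= n)%nat ->
    (alpha n * alpha n + c n * c n) * lsum (fun x => p x * p x) (L n) <= C).
  { destruct (Halpha 1) as [n1 H1]; [lra|]. destruct (Hres 1) as [n2 H2]; [lra|].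
    set (U := 2 * 1 + 2 * (2 * N + 2 * M)).
    exists (1 + (2 * (2 * M + 2 * 1) + 2 * U)), (max n1 n2). intros n Hn.
    specialize (H1 n ltac:(lia)). specialize (H2 n ltac:(lia)).
    assert (HU : sq_le (u n) U).
    { apply (skew_coercive par ch lam tree_ch_par tree_ch_nodup); [apply Hfs|].
      eapply sq_le_dom; [|exact (sq_le_plus _ _ _ _ H2 Hg)].
      intros x. cbv beta. fold B. apply Req_le. ring. }
    assert (Hh : sq_le (fun x => / 2 * if in_dec eq_dec x (K n) then alpha n * r x else 0) 1).
    { apply sq_le_weaken with (/ 2 * / 2 * (alpha n * alpha n * P n)); [lra|].
      apply sq_le_scal, Halpha_r. }
    pose proof (sq_le_minus _ _ _ _ (sq_le_plus _ _ _ _ HM Hh) HU (L n) (proj1 (HL n)))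
      as Hc.
    rewrite (lsum_ext _ (fun x => c n * c n * (p x * p x))) in Hc.
    2:{ intros x Hx. unfold u, c. rewrite (proj1 (Huc n) x Hx).
        destruct in_dec as [|Hk]; [field|]. contradict Hk. now right. }
    rewrite lsum_scal in Hc. unfold P, K in H1. simpl in H1. rewrite r_sqr in H1.
    rewrite (lsum_ext _ (fun x => p x * p x)) in H1 by (intros; apply r_sqr).
    pose proof (Rle_0_sqr (alpha n * p (xs (S n)))) as Hs. unfold Rsqr in Hs. lra. }
  assert (Hconv : sq_conv u f).
  { apply sq_conv_cauchy; [assumption|]. intros x eps He.
    destruct Hbound as (C & n1 & H1).
    destruct (proj2 HLE (x :: nil)) as [n2 H2].
    (* The threshold comes from the pointwise error, at most [2 * (a * a + b * b) * (p x * p x)],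
       where [(a * a + b * b) * Q <= C]. *)
    destruct (exhausting_unbounded L p (2 * C * (p x * p x) / eps) HLE Hp) as [n3 H3].
    exists (max n1 (max n2 n3)). intros n Hn.
    specialize (H1 n ltac:(lia)). specialize (H2 n ltac:(lia)). specialize (H3 n ltac:(lia)).
    unfold u. rewrite (proj1 (Huc n)) by (apply H2; now left). fold (c n).
    pose proof (lsum_sqr_pos p (L n)) as HQ0.
    set (Q := lsum (fun y => p y * p y) (L n)) in *.
    assert (HQ : 2 * C * (p x * p x) < eps * Q).
    { apply Rmult_lt_reg_r with (/ eps); [now apply Rinv_0_lt_compat|].
      replace (eps * Q * / eps) with Q by (field; lra). unfold Rdiv in H3. lra. }
    set (a := alpha n) in *. set (b := c n) in *.
    replace (f x + a / 2 * r x - b * p x - f x) with (a / 2 * r x - b * p x) by ring.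
    assert (E : (a / 2 * r x - b * p x) * (a / 2 * r x - b * p x)
                <= 2 * (a * a + b * b) * (p x * p x)).
    { pose proof (r_sqr x) as Er. pose proof (Rle_0_sqr (a / 2 * r x + b * p x)) as E1.
      pose proof (Rle_0_sqr (a * p x)) as E2. unfold Rsqr in E1, E2.
      assert (a * a * (r x * r x) = a * a * (p x * p x)) by now rewrite Er.
      lra. }
    assert (E2 : 2 * (p x * p x) * ((a * a + b * b) * Q) <= 2 * (p x * p x) * C).
    { apply Rmult_le_compat_l; [|assumption]. pose proof (Rle_0_sqr (p x)) as E3.
      unfold Rsqr in E3. lra. }
    eapply Rle_trans; [exact E|]. apply Rnot_lt_le. intros Hlt.
    assert (Q * eps <= Q * (2 * (a * a + b * b) * (p x * p x)))
      by (apply Rmult_le_compat_l; lra).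
    lra. }
  (* [B (u n) - B f] is the residual [B (u n) - u n - g] plus [u n - f]. *)
  exists u. split; [assumption|]. split; [assumption|]. intros eps He.
  destruct (Hres (eps / 4)) as [n1 H1]; [lra|].
  destruct (Hconv (eps / 4)) as [n2 H2]; [lra|].
  exists (max n1 n2). intros n Hn.
  specialize (H1 n ltac:(lia)). specialize (H2 n ltac:(lia)).
  apply sq_le_weaken with (2 * (eps / 4) + 2 * (eps / 4)); [lra|].
  eapply sq_le_dom; [|exact (sq_le_plus _ _ _ _ H1 H2)].
  intros x. cbv beta. unfold g. apply Req_le. ring.
Qed.

End Approximation.
End Tree.

(** * Closures and adjoints *)

Section Complex.
Context {V : Type}.
Implicit Types (v w : V -> Defs.C).

Definition re v (x : V) : R := fst (v x).
Definition im v (x : V) : R := snd (v x).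

Lemma sq_conv_ext (u u' : nat -> V -> R) f f' :
  (forall n x, u n x = u' n x) -> (forall x, f x = f' x) ->
  sq_conv u f -> sq_conv u' f'.
Proof.
  intros Hu Hf H eps He. destruct (H eps He) as [N HN]. exists N. intros n Hn.
  eapply sq_le_dom; [|exact (HN n Hn)]. intros x. cbv beta. rewrite Hu, Hf. lra.
Qed.

Lemma Cnorm2_nonneg a : 0 <= Cnorm2 a.
Proof. unfold Cnorm2. nra. Qed.

Lemma has_sum_Cnorm2 v S :
  has_sum (fun x => Cnorm2 (v x)) S -> sq_le (re v) S /\ sq_le (im v) S.
Proof.
  intros H. split; intros L HL;
    (apply Rle_trans with (lsum (fun x => Cnorm2 (v x)) L);
     [apply lsum_le; intros x _; unfold re, im, Cnorm2; nra|
      apply has_sum_partial_le; auto using Cnorm2_nonneg]).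
Qed.

Lemma sq_le_Cnorm2 v A B :
  sq_le (re v) A -> sq_le (im v) B ->
  exists S, has_sum (fun x => Cnorm2 (v x)) S /\ S <= A + B.
Proof.
  intros HA HB. apply has_sum_bounded; [intros; apply Cnorm2_nonneg|].
  intros L HL. unfold Cnorm2. rewrite lsum_plus.
  specialize (HA L HL). specialize (HB L HL). unfold re, im in *. lra.
Qed.

Lemma l2_iff v : l2 v <-> exists M, sq_le (re v) M /\ sq_le (im v) M.
Proof.
  split.
  - intros [S HS]. exists S. now apply has_sum_Cnorm2.
  - intros (M & H1 & H2). destruct (sq_le_Cnorm2 v M M H1 H2) as (S & HS & _).
    now exists S.
Qed.

Lemma l2_conv_iff (u : nat -> V -> Defs.C) v :
  l2_conv u v <-> sq_conv (fun n => re (u n)) (re v) /\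
                  sq_conv (fun n => im (u n)) (im v).
Proof.
  split.
  - intros H. split; intros eps He; destruct (H eps He) as [N HN]; exists N;
      intros n Hn; destruct (HN n Hn) as (S & HS & Hlt);
      apply has_sum_Cnorm2 in HS; apply sq_le_weaken with S; try lra; apply HS.
  - intros [H1 H2] eps He.
    destruct (H1 (eps / 4)) as [N1 HN1]; [lra|].
    destruct (H2 (eps / 4)) as [N2 HN2]; [lra|].
    exists (max N1 N2). intros n Hn.
    destruct (sq_le_Cnorm2 (fun x => Csub (u n x) (v x)) (eps / 4) (eps / 4))
      as (S & HS & Hle); [apply HN1; lia|apply HN2; lia|].
    exists S. split; [assumption|lra].
Qed.

Lemma fin_supp_iff v : fin_supp v <-> fsupp (re v) /\ fsupp (im v).
Proof.
  split.
  - intros [L HL]. split; exists L; intros x Hx; unfold re, im; now rewrite HL.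
  - intros [[L HL] [K HK]]. exists (L ++ K). intros x Hx. rewrite in_app_iff in Hx.
    rewrite (surjective_pairing (v x)). unfold re, im in *.
    rewrite HL, HK by tauto. reflexivity.
Qed.

Lemma inner_iff v w s :
  inner v w s <->
  has_sum (fun x => re v x * re w x + im v x * im w x) (fst s) /\
  has_sum (fun x => re v x * im w x - im v x * re w x) (snd s).
Proof.
  unfold inner, has_sumC, re, im. simpl.
  split; intros [H1 H2]; split;
    (eapply has_sum_ext; [|eassumption]); intros; simpl; ring.
Qed.

(** * Closure and adjoint of the Jacobi matrix with zero diagonal *)

Section Jacobi.
Variables (par : V -> V) (ch : V -> list V) (lam beta : V -> R).
Hypothesis ch_par : forall x y, In y (ch x) <-> par y = x.
Hypothesis ch_nodup : forall x, NoDup (ch x).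
Hypothesis beta_zero : forall x, beta x = 0.

Let J := jacobi par ch lam beta.
Let H := hop par ch lam 1.

Lemma re_jacobi v x : re (J v) x = H (re v) x.
Proof.
  unfold J, H, re, jacobi, hop. simpl. rewrite beta_zero.
  assert (E : forall l, fst (fold_right (fun y acc => Cadd (Rscal (lam y) (v y)) acc) C0 l)
              = lsum (fun y => lam y * fst (v y)) l).
  { induction l as [|a l IH]; simpl; congruence. }
  rewrite E. ring.
Qed.

Lemma im_jacobi v x : im (J v) x = H (im v) x.
Proof.
  unfold J, H, im, jacobi, hop. simpl. rewrite beta_zero.
  assert (E : forall l, snd (fold_right (fun y acc => Cadd (Rscal (lam y) (v y)) acc) C0 l)
              = lsum (fun y => lam y * snd (v y)) l).
  { induction l as [|a l IH]; simpl; congruence. }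
  rewrite E. ring.
Qed.

(** The coefficients are real, so real and imaginary parts can be approximated independently. *)
Lemma closure_parts v w :
  closure_graph J v w <-> l2 v /\ l2 w /\
  exists a b : nat -> V -> R,
    (forall n, fsupp (a n)) /\ (forall n, fsupp (b n)) /\
    sq_conv a (re v) /\ sq_conv (fun n => H (a n)) (re w) /\
    sq_conv b (im v) /\ sq_conv (fun n => H (b n)) (im w).
Proof.
  split; intros (Hv & Hw & Hex); (split; [assumption|]); (split; [assumption|]).
  - destruct Hex as (u & Hu & H1 & H2).
    apply l2_conv_iff in H1. apply l2_conv_iff in H2.
    exists (fun n => re (u n)), (fun n => im (u n)).
    repeat split; try (intros n; now apply fin_supp_iff); try apply H1.
    + eapply sq_conv_ext; [| |exact (proj1 H2)]; intros; [apply re_jacobi|reflexivity].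
    + eapply sq_conv_ext; [| |exact (proj2 H2)]; intros; [apply im_jacobi|reflexivity].
  - destruct Hex as (a & b & Ha & Hb & H1 & H2 & H3 & H4).
    exists (fun n x => (a n x, b n x)).
    split; [|split].
    + intros n. apply fin_supp_iff. split; [apply Ha|apply Hb].
    + now apply l2_conv_iff.
    + apply l2_conv_iff. split.
      * eapply sq_conv_ext; [| |exact H2]; intros; [symmetry; apply re_jacobi|reflexivity].
      * eapply sq_conv_ext; [| |exact H4]; intros; [symmetry; apply im_jacobi|reflexivity].
Qed.

Lemma sq_conv_const (f : V -> R) : sq_conv (fun _ => f) f.
Proof.
  intros eps He. exists O. intros n _ L _. rewrite lsum_zero; [lra|].
  intros; ring.
Qed.

Lemma closure_fin_supp v : fin_supp v -> closure_graph J v (J v).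
Proof.
  intros Hv. apply fin_supp_iff in Hv. destruct Hv as [Hr Hi].
  pose proof (fsupp_hop par ch lam ch_par 1 _ Hr) as HJr.
  pose proof (fsupp_hop par ch lam ch_par 1 _ Hi) as HJi.
  assert (Hl : forall w, fsupp (re w) -> fsupp (im w) -> l2 w).
  { intros w H1 H2. destruct (fsupp_sq_le _ H1) as [A HA].
    destruct (fsupp_sq_le _ H2) as [B HB].
    destruct (sq_le_Cnorm2 w A B HA HB) as (S & HS & _). now exists S. }
  apply closure_parts. split; [now apply Hl|]. split.
  - apply Hl.
    + eapply fsupp_dom; [|exact HJr]. intros x E. now rewrite re_jacobi.
    + eapply fsupp_dom; [|exact HJi]. intros x E. now rewrite im_jacobi.
  - exists (fun _ => re v), (fun _ => im v).
    repeat split; auto using sq_conv_const.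
    + eapply sq_conv_ext; [| |apply (sq_conv_const (H (re v)))]; intros;
        [reflexivity|symmetry; apply re_jacobi].
    + eapply sq_conv_ext; [| |apply (sq_conv_const (H (im v)))]; intros;
        [reflexivity|symmetry; apply im_jacobi].
Qed.

(** The adjoint is the maximal operator: pairing with [delta x] gives the pointwise equation, and
    summation by parts on the closure gives the converse. *)
Lemma adjoint_iff v w :
  adjoint_closure_graph J v w <->
  l2 v /\ l2 w /\ (forall x, re w x = H (re v) x /\ im w x = H (im v) x).
Proof.
  split; intros (Hv & Hw & Hadj); (split; [assumption|]); (split; [assumption|]).
  - intros x. set (d y := (delta x y, 0) : Defs.C).
    assert (Hd : fin_supp d).
    { apply fin_supp_iff. split; [apply fsupp_delta|]. now exists nil. }
    destruct (Hadj d (J d) (closure_fin_supp d Hd)) as (s & H1 & H2).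
    apply inner_iff in H1. apply inner_iff in H2.
    assert (E0 : forall y, im (J d) y = 0).
    { intros y. rewrite im_jacobi. unfold H, hop.
      rewrite lsum_zero; [|intros z _]; unfold im, d; simpl; ring. }
    assert (Hpt : forall f g t,
      has_sum (fun y => re (J d) y * f y) t -> has_sum (fun y => delta x y * g y) t ->
      g x = H f x).
    { intros f g t Hf Hg.
      destruct (hop_parts par ch lam ch_par ch_nodup 1 (delta x) f)
        as (t' & Ht & Ht'); [ring|apply fsupp_delta|].
      assert (E : t = t').
      { apply (has_sum_unique (fun y => hop par ch lam 1 (delta x) y * f y)); [|assumption].
        eapply has_sum_ext; [|exact Hf]. intros y. cbv beta. now rewrite re_jacobi. }
      rewrite (has_sum_unique _ _ _ (has_sum_delta (H f) x) Ht').
      rewrite (has_sum_unique _ _ _ (has_sum_delta g x) Hg), E. ring. }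
    split.
    + apply (Hpt _ _ (fst s)); eapply has_sum_ext; [|apply H1| |apply H2];
        intros y; cbv beta; rewrite ?E0; unfold d, re, im; simpl; ring.
    + apply (Hpt _ _ (snd s)); eapply has_sum_ext; [|apply H1| |apply H2];
        intros y; cbv beta; rewrite ?E0; unfold d, re, im; simpl; ring.
  - intros u z Hc. apply closure_parts in Hc.
    destruct Hc as (Hu & Hz & a & b & Ha & Hb & Ca & CJa & Cb & CJb).
    apply l2_iff in Hv, Hw, Hu, Hz.
    destruct Hv as (Mv & Hvr & Hvi). destruct Hw as (Mw & Hwr & Hwi).
    destruct Hu as (Mu & Hur & Hui). destruct Hz as (Mz & Hzr & Hzi).
    assert (HJr : sq_le (H (re v)) Mw).
    { eapply sq_le_dom; [|exact Hwr]. intros x. cbv beta. rewrite (proj1 (Hadj x)). lra. }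
    assert (HJi : sq_le (H (im v)) Mw).
    { eapply sq_le_dom; [|exact Hwi]. intros x. cbv beta. rewrite (proj2 (Hadj x)). lra. }
    assert (Hparts : forall e f y g h, (forall n, fsupp (e n)) -> sq_conv e f ->
      sq_conv (fun n => H (e n)) y -> sq_le f Mu -> sq_le y Mz ->
      sq_le g Mv -> sq_le (H g) Mw -> (forall x, h x = H g x) ->
      exists t, has_sum (fun x => y x * g x) t /\ has_sum (fun x => f x * h x) t).
    { intros e f y g h He Cf Cy Hf Hy Hg HHg Hh.
      destruct (hop_parts_closure par ch lam ch_par ch_nodup 1 e f y g Mu Mz Mv Mw)
        as (t & Ht & Ht'); auto; [ring|].
      exists t. split; [assumption|]. rewrite Rmult_1_l in Ht'.
      eapply has_sum_ext; [|exact Ht']. intros x. cbv beta. now rewrite Hh. }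
    (* The four real pairings combine into the inner product as [t1 + t2] (real part) and [t3 - t4]
       (imaginary part). *)
    destruct (Hparts a (re u) (re z) (re v) (re w)) as (t1 & P1 & Q1); auto;
      [intros; apply Hadj|].
    destruct (Hparts b (im u) (im z) (im v) (im w)) as (t2 & P2 & Q2); auto;
      [intros; apply Hadj|].
    destruct (Hparts a (re u) (re z) (im v) (im w)) as (t3 & P3 & Q3); auto;
      [intros; apply Hadj|].
    destruct (Hparts b (im u) (im z) (re v) (re w)) as (t4 & P4 & Q4); auto;
      [intros; apply Hadj|].
    exists (t1 + t2, t3 - t4). split; apply inner_iff; simpl; split;
      auto using has_sum_plus, has_sum_minus.
Qed.

Lemma closure_adjoint v w : closure_graph J v w -> adjoint_closure_graph J v w.
Proof.
  intros Hc. apply closure_parts in Hc. apply adjoint_iff.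
  destruct Hc as (Hv & Hw & a & b & Ha & Hb & Ca & CJa & Cb & CJb).
  split; [assumption|]. split; [assumption|]. intros x.
  apply l2_iff in Hv, Hw. destruct Hv as (Mv & ? & ?). destruct Hw as (Mw & ? & ?).
  split.
  - apply (hop_closed par ch lam ch_par ch_nodup 1 a _ _ Mv Mw); auto; ring.
  - apply (hop_closed par ch lam ch_par ch_nodup 1 b _ _ Mv Mw); auto; ring.
Qed.

(** Here [w = i v]. Once [(v, w)] lies in the closure, it can be paired with itself, and the
    imaginary part of that pairing is both [- S] and [S]. *)
Lemma selfadjoint_real_spectrum v w S :
  ess_selfadjoint J -> adjoint_closure_graph J v w ->
  (forall x, re w x = - im v x) -> (forall x, im w x = re v x) ->
  has_sum (fun x => Cnorm2 (v x)) S -> S = 0.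
Proof.
  intros Hess Hadj Hre Him HS. pose proof (proj2 (Hess v w) Hadj) as Hc.
  destruct Hadj as (_ & _ & Hadj). destruct (Hadj v w Hc) as (s & H1 & H2).
  apply inner_iff in H1. apply inner_iff in H2.
  assert (E1 : snd s = - 1 * S).
  { apply (has_sum_unique (fun x => - 1 * Cnorm2 (v x))); [|now apply has_sum_scal].
    eapply has_sum_ext; [|apply H1]. intros x. cbv beta. rewrite Hre, Him.
    unfold Cnorm2, re, im. ring. }
  assert (E2 : snd s = S).
  { apply (has_sum_unique (fun x => Cnorm2 (v x))); [|assumption].
    eapply has_sum_ext; [|apply H2]. intros x. cbv beta. rewrite Hre, Him.
    unfold Cnorm2, re, im. ring. }
  lra.
Qed.

End Jacobi.
End Complex.

(** * Powers of the imaginary unit *)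

Fixpoint i_pow_re (n : nat) : R :=
  match n with
  | O => 1
  | S O => 0
  | S (S m) => - i_pow_re m
  end.

(** Multiplying by [i] turns the imaginary part into minus the real part. *)
Definition i_pow_im (n : nat) : R := - i_pow_re (S n).

Lemma i_pow_norm n : i_pow_re n * i_pow_re n + i_pow_im n * i_pow_im n = 1.
Proof.
  unfold i_pow_im. induction n as [|n IH]; [simpl; ring|].
  rewrite <- IH. change (i_pow_re (S (S n))) with (- i_pow_re n). ring.
Qed.

Lemma i_pow_mul n : i_pow_re n * i_pow_im n = 0.
Proof.
  unfold i_pow_im. induction n as [|n IH]; [simpl; ring|].
  change (i_pow_re (S (S n))) with (- i_pow_re n). lra.
Qed.

(** * Essential selfadjointness in terms of the positive solution *)

Section Criterion.
Context {V : Type} (lev : V -> nat) (par : V -> V) (ch : V -> list V).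
Context (lam beta : V -> R).
Hypothesis tree : leveled_tree lev par ch.
Hypothesis beta_zero : forall x, beta x = 0.
Variable p : V -> R.
Hypothesis p_pos : forall x, 0 < p x.
Hypothesis p_eq : forall x, hop par ch lam (-1) p x = p x.

(** The vector [v = i ^ lev * p] is an eigenvector of the adjoint for the eigenvalue [i], with
    [w = i v]; it is nonzero at [x0]. *)
Lemma l2_not_ess_selfadjoint (x0 : V) M :
  sq_le p M -> ~ ess_selfadjoint (jacobi par ch lam beta).
Proof.
  intros HM Hess.
  set (v x := (i_pow_re (lev x) * p x, i_pow_im (lev x) * p x) : Defs.C).
  set (w x := (- i_pow_im (lev x) * p x, i_pow_re (lev x) * p x) : Defs.C).
  assert (Hnorm : forall x, Cnorm2 (v x) = p x * p x).
  { intros x. unfold Cnorm2, v. simpl.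
    transitivity ((i_pow_re (lev x) * i_pow_re (lev x)
                   + i_pow_im (lev x) * i_pow_im (lev x)) * (p x * p x)); [ring|].
    rewrite i_pow_norm. ring. }
  destruct (sq_le_has_sum p M HM) as (S & HS & _).
  assert (HvS : has_sum (fun x => Cnorm2 (v x)) S).
  { eapply has_sum_ext; [|exact HS]. intros x. cbv beta. now rewrite Hnorm. }
  assert (HwS : has_sum (fun x => Cnorm2 (w x)) S).
  { eapply has_sum_ext; [|exact HvS]. intros x. unfold Cnorm2, v, w. simpl. ring. }
  assert (S = 0).
  { apply (selfadjoint_real_spectrum par ch lam beta v w); auto.
    - apply (adjoint_iff par ch lam beta); try apply tree; auto.
      split; [now exists S|]. split; [now exists S|]. intros x. split.
      + change (- i_pow_im (lev x) * p x
                = hop par ch lam 1 (fun y => i_pow_re (lev y) * p y) x).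
        rewrite (hop_gauge lev par ch lam tree), p_eq by reflexivity.
        unfold i_pow_im. ring.
      + change (i_pow_re (lev x) * p x
                = hop par ch lam 1 (fun y => i_pow_im (lev y) * p y) x).
        rewrite (hop_gauge lev par ch lam tree), p_eq
          by (intros n; unfold i_pow_im; simpl; ring).
        unfold i_pow_im. simpl. ring.
    - intros x. unfold re, im, v, w. simpl. ring. }
  pose proof (has_sum_partial_le _ _ (x0 :: nil) (fun x => Rle_0_sqr (p x)) HS) as Hx.
  specialize (Hx ltac:(repeat constructor; simpl; tauto)). simpl in Hx.
  specialize (p_pos x0). unfold Rsqr in Hx. nra.
Qed.

Lemma not_l2_ess_selfadjoint (xs : nat -> V) :
  (forall n, lev (xs n) = n) -> (forall n, par (xs n) = xs (S n)) ->
  ~ (exists M, sq_le p M) -> ess_selfadjoint (jacobi par ch lam beta).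
Proof.
  intros lev_xs par_xs Hp v w.
  split; [apply closure_adjoint; auto; apply tree|]. intros Hadj.
  apply adjoint_iff in Hadj; try apply tree; auto.
  destruct Hadj as (Hv & Hw & Heq). apply closure_parts; auto.
  split; [assumption|]. split; [assumption|].
  apply l2_iff in Hv, Hw. destruct Hv as (M & Hvr & Hvi). destruct Hw as (N & Hwr & Hwi).
  (* The sign sequence 1, 1, -1, -1, ... is a real substitute for [i ^ n]: it also satisfies the
     gauge condition and preserves norms, so real and imaginary parts need not be mixed. *)
  set (s n := i_pow_re n + i_pow_im n).
  assert (s_sqr : forall n, s n * s n = 1).
  { intros n. unfold s. pose proof (i_pow_norm n). pose proof (i_pow_mul n). nra. }
  assert (s_anti : forall n, s (S (S n)) = - s n).
  { intros n. unfold s, i_pow_im. simpl. ring. }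
  assert (Happ : forall f h, (forall x, h x = hop par ch lam 1 f x) ->
    sq_le f M -> sq_le h N ->
    exists a : nat -> V -> R, (forall n, fsupp (a n)) /\ sq_conv a f /\
      sq_conv (fun n => hop par ch lam 1 (a n)) h).
  { intros f h Hh Hf HhN. set (f' x := s (lev x) * f x).
    assert (Ef : forall g x, s (lev x) * (s (lev x) * g x) = g x).
    { intros g x. rewrite <- Rmult_assoc, s_sqr. ring. }
    assert (Esq : forall n t, s n * t * (s n * t) = t * t).
    { intros n t. transitivity (s n * s n * (t * t)); [ring|]. rewrite s_sqr. ring. }
    assert (Eh : forall g x, hop par ch lam 1 (fun y => s (lev y) * g y) x
                 = s (S (lev x)) * hop par ch lam (-1) g x).
    { intros g x. now apply hop_gauge. }
    assert (Eh' : forall x, h x = s (S (lev x)) * hop par ch lam (-1) f' x).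
    { intros x. rewrite Hh, <- Eh. apply hop_ext. intros y. symmetry. apply Ef. }
    destruct (sq_approximation lev par ch lam tree xs lev_xs par_xs p p_pos p_eq f' M N)
      as (u & Hu & Cu & CBu).
    - assumption.
    - eapply sq_le_dom; [|exact Hf]. intros x. unfold f'. rewrite Esq. lra.
    - eapply sq_le_dom; [|exact HhN]. intros x. cbv beta. rewrite Eh', Esq. lra.
    - exists (fun n x => s (lev x) * u n x). split; [|split].
      + intros n. eapply fsupp_dom; [|exact (Hu n)]. intros x E. cbv beta. rewrite E. ring.
      + intros eps He. destruct (Cu eps He) as [n0 H0]. exists n0. intros n Hn.
        eapply sq_le_dom; [|exact (H0 n Hn)]. intros x. cbv beta.
        rewrite <- (Ef f x). fold (f' x). rewrite <- Rmult_minus_distr_l, Esq. lra.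
      + intros eps He. destruct (CBu eps He) as [n0 H0]. exists n0. intros n Hn.
        eapply sq_le_dom; [|exact (H0 n Hn)]. intros x. cbv beta.
        rewrite Eh, Eh', <- Rmult_minus_distr_l, Esq. lra. }
  destruct (Happ (re v) (re w)) as (a & Ha & Ca & CJa); auto; [intros; apply Heq|].
  destruct (Happ (im v) (im w)) as (b & Hb & Cb & CJb); auto; [intros; apply Heq|].
  exists a, b. repeat split; assumption.
Qed.

End Criterion.

(** * The half-line and comparison along the path *)

Lemma half_line_tree : leveled_tree (fun n => n) S nat_children.
Proof.
  split; [reflexivity|]. split; [|split; [|split]].
  - intros [|x] y; simpl; split; try lia; intuition lia.
  - intros [|x]; simpl; repeat constructor; simpl; tauto.
  - intros [|x]; simpl; [lia|discriminate].
  - assert (Hup : forall x, clos_refl_trans nat (adj S) 0%nat x).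
    { induction x as [|x IH]; [apply rt_refl|].
      eapply rt_trans; [exact IH|]. apply rt_step. now left. }
    assert (Hdown : forall x, clos_refl_trans nat (adj S) x 0%nat).
    { induction x as [|x IH]; [apply rt_refl|].
      eapply rt_trans; [|exact IH]. apply rt_step. now right. }
    intros x y. eapply rt_trans; eauto.
Qed.

(** Both sequences are generated upwards by recursions with nonnegative coefficients, and [p]
    receives extra nonnegative terms from children off the path. *)
Lemma path_comparison {V} (lev : V -> nat) (par : V -> V) (ch : V -> list V)
  (lam : V -> R) (p : V -> R) (q : nat -> R) (xs : nat -> V) :
  leveled_tree lev par ch -> (forall x, 0 < lam x) -> (forall x, 0 < p x) ->
  (forall n, 0 < q n) -> (forall n, par (xs n) = xs (S n)) ->
  (forall x, hop par ch lam (-1) p x = p x) ->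
  (forall n, hop S nat_children (fun n => lam (xs n)) (-1) q n = q n) ->
  forall n, p (xs 0%nat) * q n <= q 0%nat * p (xs n).
Proof.
  intros tree lam_pos p_pos q_pos par_xs p_eq q_eq.
  assert (Hpos : forall y, 0 <= lam y * p y).
  { intros y. left. now apply Rmult_lt_0_compat. }
  (* The recursion has order two, so two consecutive inequalities are carried along. *)
  assert (Hstep : forall n,
    (p (xs 0%nat) * q n <= q 0%nat * p (xs n)) /\
    (p (xs 0%nat) * q (S n) <= q 0%nat * p (xs (S n)))); [|intros n; apply Hstep].
  induction n as [|n [IH1 IH2]].
  - split; [lra|]. pose proof (p_eq (xs 0%nat)) as Ep. pose proof (q_eq 0%nat) as Eq.
    unfold hop in Ep, Eq. simpl in Eq. rewrite par_xs in Ep.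
    assert (0 <= lsum (fun y => lam y * p y) (ch (xs 0%nat))) by (apply lsum_pos; auto).
    apply Rmult_le_reg_l with (lam (xs 0%nat)); [apply lam_pos|].
    specialize (q_pos 0%nat). nra.
  - split; [assumption|]. pose proof (p_eq (xs (S n))) as Ep. pose proof (q_eq (S n)) as Eq.
    unfold hop in Ep, Eq. simpl in Eq. rewrite par_xs in Ep.
    assert (Hn : lam (xs n) * p (xs n) <= lsum (fun y => lam y * p y) (ch (xs (S n)))).
    { apply Rle_trans with (lsum (fun y => lam y * p y) (xs n :: nil)); [simpl; lra|].
      apply lsum_incl_le; auto; [repeat constructor; simpl; tauto|].
      intros y [<-|[]]. apply tree. apply par_xs. }
    pose proof (lam_pos (xs n)) as Hl.
    assert (E1 : lam (xs n) * (p (xs 0%nat) * q n) <= lam (xs n) * (q 0%nat * p (xs n)))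
      by (apply Rmult_le_compat_l; lra).
    assert (E2 : q 0%nat * (lam (xs n) * p (xs n))
                 <= q 0%nat * lsum (fun y => lam y * p y) (ch (xs (S n)))).
    { apply Rmult_le_compat_l; [|assumption]. specialize (q_pos 0%nat). lra. }
    apply Rmult_le_reg_l with (lam (xs (S n))); [apply lam_pos|].
    replace (lam (xs (S n)) * (p (xs 0%nat) * q (S (S n))))
      with (p (xs 0%nat) * (lam (xs (S n)) * q (S (S n)))) by ring.
    replace (lam (xs (S n)) * (q 0%nat * p (xs (S (S n)))))
      with (q 0%nat * (lam (xs (S n)) * p (xs (S (S n))))) by ring.
    replace (lam (xs (S n)) * q (S (S n))) with (q (S n) + lam (xs n) * q n) by lra.
    replace (lam (xs (S n)) * p (xs (S (S n))))
      with (p (xs (S n)) + lsum (fun y => lam y * p y) (ch (xs (S n)))) by lra.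
    lra.
Qed.

Lemma lsum_map {V W} (k : V -> W) (f : W -> R) (L : list V) :
  lsum f (map k L) = lsum (fun x => f (k x)) L.
Proof. induction L as [|a L IH]; simpl; [|rewrite IH]; reflexivity. Qed.

Theorem theorem4 :
  forall (V : Type) (lev : V -> nat) (par : V -> V) (ch : V -> list V)
         (lam beta : V -> R),
    leveled_tree lev par ch ->
    (forall x, 0 < lam x) ->
    (forall x, beta x = 0) ->
    ~ ess_selfadjoint (jacobi par ch lam beta) ->
    forall xs : nat -> V,
      (forall n, lev (xs n) = n) ->
      (forall n, par (xs n) = xs (S n)) ->
      ~ ess_selfadjoint (J0 (fun n => lam (xs n))).
Proof.
  intros V lev par ch lam beta tree lam_pos beta_zero Hess xs lev_xs par_xs.
  destruct (positive_solution lev par ch lam tree lam_pos xs lev_xs par_xs)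
    as (p & p_pos & p_eq).
  destruct (positive_solution (fun n => n) S nat_children (fun n => lam (xs n))
    half_line_tree (fun n => lam_pos (xs n)) (fun n => n)) as (q & q_pos & q_eq);
    [reflexivity|reflexivity|].
  destruct (classic (exists M, sq_le p M)) as [[M HM]|Hp].
  2:{ destruct Hess. now apply (not_l2_ess_selfadjoint lev par ch lam beta tree
        beta_zero p p_pos p_eq xs). }
  set (c := q 0%nat / p (xs 0%nat)).
  (* Distinct path vertices have distinct levels, so sums along the path are partial sums over the
     tree. *)
  assert (Hxs : sq_le (fun n => p (xs n)) M).
  { intros L HL. rewrite <- (lsum_map xs (fun x => p x * p x)). apply HM.
    apply FinFun.Injective_map_NoDup; [|assumption].
    intros n m E. apply (f_equal lev) in E. now rewrite !lev_xs in E. }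
  apply (l2_not_ess_selfadjoint (fun n => n) S nat_children (fun n => lam (xs n))
    (fun _ => 0) half_line_tree (fun _ => eq_refl) q q_pos q_eq 0%nat (c * c * M)).
  eapply sq_le_dom; [|exact (sq_le_scal c _ _ Hxs)]. intros n. cbv beta.
  pose proof (path_comparison lev par ch lam p q xs tree lam_pos p_pos q_pos par_xs
    p_eq q_eq n) as Hn.
  assert (q n <= c * p (xs n)).
  { apply Rmult_le_reg_l with (p (xs 0%nat)); [apply p_pos|]. unfold c.
    replace (p (xs 0%nat) * (q 0%nat / p (xs 0%nat) * p (xs n)))
      with (q 0%nat * p (xs n)) by (field; specialize (p_pos (xs 0%nat)); lra).
    assumption. }
  specialize (q_pos n). nra.
Qed.
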